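(* Let a scalar function $\alpha$ and a $2\times2$ matrix function $u$ satisfy $$\big(\alpha u_{\xi}u^{-1}\big)_{\eta}+\big(\alpha u_{\eta}u^{-1}\big)_{\xi}=0,\qquad \alpha_{\xi\eta}=0,\qquad \alpha(\xi,\eta)\in\mathbb{R},\qquad u(\xi,\eta)\in \mathrm{GL}(2,\mathbb{R}),$$ and put $q:=u_{\xi}u^{-1}$, $Q:=-u_{\eta}u^{-1}$. Let $J$ be a $2\times2$ matrix with $$\mathrm{i}J\in\mathrm{GL}(2,\mathbb{R}),\qquad J=J^*=J^{-1},\qquad qJ=-Jq^*,\qquad QJ=-JQ^*.$$ Let $\{\mathcal{A},S(0,0),\Pi(0,0)\}$ be a triple of matrices with $$\mathcal{A},\,S(0,0)\in\mathrm{GL}(n,\mathbb{R}),\quad \Pi(0,0)\in\mathbb{R}^{n\times2},\quad S(0,0)=S(0,0)^*,\quad \mathcal{A}S(0,0)-S(0,0)\mathcal{A}^*=\mathrm{i}\,\Pi(0,0)J\Pi(0,0)^*.$$ Assume additionally that $$d:=\det\Big(\big(I_2-\mathrm{i}J\Pi(0,0)^*S(0,0)^{-1}\mathcal{A}^{-1}\Pi(0,0)\big)u(0,0)\Big)>0.$$ Let $A(\xi,\eta)$, $\Pi(\xi,\eta)$, $S(\xi,\eta)$ be determined by $A(0,0)=\mathcal{A}$, by the values $\Pi(0,0)$, $S(0,0)$, and by the equations $$A_{\xi}=-\frac{\alpha_{\xi}}{\alpha}A-\frac{2\alpha_{\xi}}{\alpha}I_n-\frac{2\alpha_{\xi}}{\alpha}(A-I_n)^{-1},\qquad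 A_{\eta}=-\frac{\alpha_{\eta}}{\alpha}A+\frac{2\alpha_{\eta}}{\alpha}I_n-\frac{2\alpha_{\eta}}{\alpha}(A+I_n)^{-1},$$ $$\Pi_{\xi}=(A-I_n)^{-1}\Pi q,\qquad \Pi_{\eta}=(A+I_n)^{-1}\Pi Q,$$ $$S_{\xi}=\frac{\alpha_{\xi}}{\alpha}\Big(S-2(A-I_n)^{-1}S(A^*-I_n)^{-1}\Big)-\mathrm{i}(A-I_n)^{-1}\Pi qJ\Pi^*(A^*-I_n)^{-1},$$ $$S_{\eta}=\frac{\alpha_{\eta}}{\alpha}\Big(S-2(A+I_n)^{-1}S(A^*+I_n)^{-1}\Big)-\mathrm{i}(A+I_n)^{-1}\Pi QJ\Pi^*(A^*+I_n)^{-1},$$ and set $$\mathcal{U}(\xi,\eta):=I_2-\mathrm{i}J\Pi(\xi,\eta)^*S(\xi,\eta)^{-1}A(\xi,\eta)^{-1}\Pi(\xi,\eta),\qquad \widetilde{u}(\xi,\eta):=\alpha(\xi,\eta)\,d^{-1/2}\,\mathcal{U}(\xi,\eta)\,u(\xi,\eta).$$ Then $\alpha$ and $\widetilde{u}$ satisfy $$\big(\alpha\,\widetilde{u}_{\xi}\,\widetilde{u}^{-1}\big)_{\eta}+\big(\alpha\,\widetilde{u}_{\eta}\,\widetilde{u}^{-1}\big)_{\xi}=0,\qquad \alpha_{\xi\eta}=0,\qquad \alpha\in\mathbb{R},\qquad \widetilde{u}(\xi,\eta)\in\mathrm{GL}(2,\mathbb{R}),\qquad \det\widetilde{u}=\a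lpha^2.$$
   Context: Here $n\in\mathbb{N}$, $\mathrm{i}$ is the imaginary unit, $I_k$ is the $k\times k$ identity matrix, $M^*$ is the conjugate transpose of $M$ (and $A^*(\xi,\eta)=A(\xi,\eta)^*$), $\mathrm{GL}(k,\mathbb{R})$ is the set of invertible $k\times k$ matrices with real entries, and subscripts $\xi,\eta$ denote partial derivatives. The real variables $(\xi,\eta)$ range over a connected open set (e.g. an open rectangle) $D\subset\mathbb{R}^2$ containing $(0,0)$. Standing assumptions: $\alpha(\xi,\eta)=f(\xi)+h(\eta)$ with $f,h$ real-valued and continuously differentiable (this is the meaning of $\alpha_{\xi\eta}=0$); $\alpha$ does not vanish on $D$; $q$ and $Q$ are continuously differentiable; the solutions $A,\Pi,S$ exist on $D$, with $A-I_n$ and $A+I_n$ invertible there. Formulas containing $S^{-1}$ and $A^{-1}$, and the assertions about $\widetilde{u}$, are considered at the points where $S(\xi,\eta)$ and $A(\xi,\eta)$ are invertible. *)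

(* Defs.v *)
From mathcomp Require Import all_boot all_order all_algebra.
From mathcomp Require Import complex.
From mathcomp Require Import all_classical all_reals all_analysis.
Set Implicit Arguments.
Unset Strict Implicit.
Unset Printing Implicit Defensive.
Import Order.TTheory GRing.Theory Num.Theory.
Import numFieldNormedType.Exports.
Local Open Scope classical_set_scope.
Local Open Scope ring_scope.
Local Open Scope complex_scope.
Local Open Scope sesquilinear_scope.

(* 'D_(xi_dir R) and 'D_(eta_dir R) are the partial derivatives with respect to
   the first variable xi and the second variable eta of a point of R * R. *)
Definition xi_dir (R : realType) : R * R := (1, 0).
Definition eta_dir (R : realType) : R * R := (0, 1).

(* R[i] is not a normed space over R in the library, so partial derivatives of
   complex matrix functions of real variables are taken on the real and the
   imaginary parts of the entries. *)
Definition re_entry (R : realType) (k l : nat) (F : R * R -> 'M[R[i]]_(k, l))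
  (i : 'I_k) (j : 'I_l) (z : R * R) : R := complex.Re (F z i j).

Definition im_entry (R : realType) (k l : nat) (F : R * R -> 'M[R[i]]_(k, l))
  (i : 'I_k) (j : 'I_l) (z : R * R) : R := complex.Im (F z i j).

Definition pderivable (R : realType) (k l : nat) (v : R * R)
  (F : R * R -> 'M[R[i]]_(k, l)) (p : R * R) : Prop :=
  forall i j, derivable (re_entry F i j) p v /\ derivable (im_entry F i j) p v.

Definition pderive (R : realType) (k l : nat) (v : R * R)
  (F : R * R -> 'M[R[i]]_(k, l)) (p : R * R) : 'M[R[i]]_(k, l) :=
  \matrix_(i, j) ('D_v (re_entry F i j) p +i* 'D_v (im_entry F i j) p).

Definition is_pderive (R : realType) (k l : nat) (v : R * R)
  (F : R * R -> 'M[R[i]]_(k, l)) (p : R * R) (G : 'M[R[i]]_(k, l)) : Prop :=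
  pderivable v F p /\ pderive v F p = G.

Definition C1_on (R : realType) (k l : nat) (D : set (R * R))
  (F : R * R -> 'M[R[i]]_(k, l)) : Prop :=
  forall p, D p -> forall v, v = xi_dir R \/ v = eta_dir R ->
    pderivable v F p /\
    forall i j, {for p, continuous (re_entry (pderive v F) i j)} /\
                {for p, continuous (im_entry (pderive v F) i j)}.

(* The meaning of alpha_{xi eta} = 0 for a real function alpha: it is the sum of
   a continuously differentiable function of xi and one of eta (only their
   values on the two projections of D matter). *)
Definition zero_mixed_partial (R : realType) (D : set (R * R))
  (alpha : R * R -> R) : Prop :=
  exists f h : R -> R, forall p, D p ->
    [/\ alpha p = f p.1 + h p.2,
        derivable f p.1 1, {for p.1, continuous (derive1 f)},
        derivable h p.2 1 & {for p.2, continuous (derive1 h)}].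

(* The logarithmic derivative alpha_v / alpha, as a complex scalar. *)
Definition dlog (R : realType) (v : R * R) (alpha : R * R -> R) (p : R * R)
  : R[i] := ('D_v alpha p / alpha p)%:C.

(* u_v u^-1 *)
Definition mxdlog (R : realType) (k : nat) (v : R * R)
  (u : R * R -> 'M[R[i]]_k) (p : R * R) : 'M[R[i]]_k :=
  pderive v u p *m invmx (u p).

(* (alpha u_xi u^-1)_eta + (alpha u_eta u^-1)_xi = 0 on D, all the derivatives
   involved being required to exist. *)
Definition field_equation (R : realType) (k : nat) (D : set (R * R))
  (alpha : R * R -> R) (u : R * R -> 'M[R[i]]_k) : Prop :=
  let Fxi z := (alpha z)%:C *: mxdlog (xi_dir R) u z in
  let Feta z := (alpha z)%:C *: mxdlog (eta_dir R) u z in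
  forall p, D p ->
    [/\ pderivable (xi_dir R) u p, pderivable (eta_dir R) u p,
        pderivable (eta_dir R) Fxi p, pderivable (xi_dir R) Feta p &
        pderive (eta_dir R) Fxi p + pderive (xi_dir R) Feta p = 0].

(* Complex matrices lying in GL(k, R). *)
Definition realGL (R : realType) (k : nat) (M : 'M[R[i]]_k) : Prop :=
  M \is a realmx /\ M \in unitmx.

(* I_2 - i J Pi^* S^-1 A^-1 Pi *)
Definition darboux (R : realType) (n : nat) (J : 'M[R[i]]_2)
  (A S : 'M[R[i]]_n) (Pi : 'M[R[i]]_(n, 2)) : 'M[R[i]]_2 :=
  1%:M - 'i *: (J *m Pi^t* *m invmx S *m invmx A *m Pi).

(* Main.v *)
Require Import Defs.
From mathcomp Require Import all_boot all_order all_algebra.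
From mathcomp Require Import complex.
From mathcomp Require Import all_classical all_reals all_analysis.
From mathcomp Require Import ring lra.
Import Order.TTheory GRing.Theory Num.Theory.
Import numFieldNormedType.Exports.
Set Implicit Arguments.
Unset Strict Implicit.
Unset Printing Implicit Defensive.
Local Open Scope classical_set_scope.
Local Open Scope ring_scope.

(** Put K = iJ, B = (A + s)^-1 with s = -1 in the xi-direction and s = 1 in the
eta-direction, G = K Pi^* S^-1, w = 1 - G B Pi and U = 1 - G A^-1 Pi (the Darboux
matrix).  Each F among A, Pi and S stays real, because F - conj F vanishes at
(0,0) and solves a homogeneous linear equation along both directions.  The identity
A S - S A^* = Pi K Pi^* has zero derivative along both flows, so it propagates
from (0,0) to D; hence det U = det (A^-1 S A^* S^-1) = 1.

Set N = alpha G Pi.  The flows give U_xi = Q1 U - U q and N_xi = alpha (q - Q1)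
with one and the same Q1 = w q w^-1 - 2 (alpha_xi / alpha) G B^2 Pi w^-1, and
similarly in the eta-direction.  So the currents alpha v_xi v^-1 and
alpha v_eta v^-1 of v = U u are alpha q - N_xi and - alpha Q + N_eta, and the
field equation for v reduces to the one for u and N_xi_eta = N_eta_xi.  The
extra factor alpha of the transformed solution only adds alpha_xi and alpha_eta
to the currents.

The equality of the mixed derivatives of N needs joint continuity, whereas A, Pi
and S are only known to satisfy their equations along coordinate lines; it
follows because their xi-derivatives are bounded as long as they stay close to
their value at a point. *)

(** * Differential inequalities on segments *)

(** All derivatives in sight are directional derivatives of entries along the two axes, so a
    solution can only be followed along axis-parallel segments: each propagation is a one-variable
    estimate on such segments, joined inside small boxes. Reality is settled first: over real
    matrices adjoints become transposes and every formula is rational in real entries, so regularity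
    passes through it by closure under field operations.

    The factor alpha in N is there because G Pi has xi-derivative q - Q1 - (alpha_xi / alpha) G Pi;
    multiplying by alpha removes the last term. The mixed derivatives of N exist although alpha is
    only C1, since alpha_xi does not depend on eta.

    As K^2 = -1, the relation q J = - J q^* forces tr q = 0, and likewise tr Q = 0. So det u is
    constant; with det U = 1 its value is d. The factor d^(-1/2) thus normalizes U u to determinant
    1, and the scalar alpha in size 2 contributes alpha^2. *)

Lemma is_derive_line (R : realType) (V : normedModType R) (f : V -> R)
  (p v : V) (t l : R) :
  is_derive (p + t *: v) v f l -> is_derive t 1 (fun r => f (p + r *: v)) l.
Proof.
move=> [df <-].
have E : (fun h : R => h^-1 *: (f (p + (h *: (1 : R) + t) *: v) - f (p + t *: v)))
       = (fun h => h^-1 *: (f (h *: v + (p + t *: v)) - f (p + t *: v))).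
  apply/funext => h; congr (_ *: (f _ - _)).
  by rewrite [h *: 1]mulr1 scalerDl addrCA.
by split; [move: df; rewrite /derivable E | rewrite /derive E].
Qed.

Section DerivePointwise.
Variables (R : realType) (V : normedModType R) (x v : V).
Implicit Types f g : V -> R.

Lemma is_deriveD_fun f g df dg :
  is_derive x v f df -> is_derive x v g dg ->
  is_derive x v (fun z => f z + g z) (df + dg).
Proof. exact: is_deriveD. Qed.

Lemma is_deriveM_fun f g df dg :
  is_derive x v f df -> is_derive x v g dg ->
  is_derive x v (fun z => f z * g z) (df * g x + f x * dg).
Proof.
move=> hf hg; apply: (is_derive_eq (is_deriveM hf hg)).
by rewrite addrC [g x *: _]mulrC.
Qed.

Lemma is_derive_sum_fun (I : Type) (r : seq I) (f : I -> V -> R) (df : I -> R) :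
  (forall i, is_derive x v (f i) (df i)) ->
  is_derive x v (fun z => \sum_(i <- r) f i z) (\sum_(i <- r) df i).
Proof.
move=> H; elim: r => [|i r IH].
  rewrite big_nil; have -> : (fun z => \sum_(i <- [::]) f i z) = cst 0.
    by apply/funext => z; rewrite big_nil.
  exact: is_derive_cst.
rewrite big_cons; have -> : (fun z => \sum_(j <- i :: r) f j z) =
    (fun z => f i z + \sum_(j <- r) f j z).
  by apply/funext => z; rewrite big_cons.
exact: is_deriveD_fun.
Qed.

End DerivePointwise.

Lemma is_derive_segment (R : realType) (f : R * R -> R) (p v : R * R)
  (h t l : R) : is_derive (p + (t * h) *: v) v f l ->
  is_derive t 1 (fun r => f (p + (r * h) *: v)) (l * h).
Proof.
move=> df; have dl : is_derive t 1 (fun r => r * h) h.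
  apply: (is_derive_eq (is_deriveM_fun (is_derive_id t 1) (is_derive_cst _ _ _))).
  by rewrite mul1r mulr0 addr0.
exact: (@is_derive1_comp _ (fun r => f (p + r *: v)) (fun r => r * h) t _ _
  (is_derive_line df) dl).
Qed.

(** Cauchy-Schwarz against the constant vector, obtained by summing [(x i - x j)^2 >= 0] over all
    pairs. *)
Lemma sqr_sum_le (R : realType) (I : finType) (x : I -> R) :
  (\sum_i x i) ^+ 2 <= #|I|%:R * \sum_i x i ^+ 2.
Proof.
rewrite expr2 mulr_suml.
have -> : #|I|%:R * \sum_i x i ^+ 2 =
    \sum_i \sum_j (x i ^+ 2 + x j ^+ 2) / 2.
  under [RHS]eq_bigr => i _ do rewrite -mulr_suml big_split /= sumr_const.
  rewrite -mulr_suml big_split /= sumr_const sumrMnl -mulr_natl.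
  by rewrite -mulr_natl; field.
apply: ler_sum => i _; rewrite mulr_sumr; apply: ler_sum => j _.
by have := sqr_ge0 (x i - x j); nra.
Qed.

(** Squares replace absolute values to get a differentiable quantity: [g], the sum of the [y_j^2],
    satisfies [g' <= c g], so [g exp(- c t)] is nonincreasing from 0 and the nonnegative [g]
    vanishes at 1. *)
Lemma gronwall_eq0 (R : realType) (I : finType) (y dy : I -> R -> R) (C : R) :
  (forall t : R, 0 <= t <= 1 -> forall i, is_derive t 1 (y i) (dy i t)) ->
  (forall t : R, 0 <= t <= 1 -> forall i, `|dy i t| <= C * \sum_j `|y j t|) ->
  (forall i, y i 0 = 0) -> forall i, y i 1 = 0.
Proof.
move=> ydy dyC y0 i.
pose g t := \sum_j y j t ^+ 2.
(* By Cauchy-Schwarz [g'] is at most [2 |C|] times the square of the sum of the [|y_j|], hence at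
   most [2 |C| #|I| g]. *)
pose c := `|C| * #|I|%:R * 2.
pose h t := g t * expR (- c * t).
have dh (t : R) : 0 <= t <= 1 -> is_derive t 1 h
    ((\sum_j y j t * dy j t * 2 - c * g t) * expR (- c * t)).
  move=> t01.
  have dg : is_derive t 1 g (\sum_j y j t * dy j t * 2).
    apply: is_derive_sum_fun => j.
    have yj := ydy t t01 j; have -> : (fun z => y j z ^+ 2) = (fun z => y j z * y j z).
      by apply/funext => z; rewrite expr2.
    apply: (is_derive_eq (is_deriveM_fun yj yj)).
    by rewrite mulr2n mulrDr mulr1 [dy j t * _]mulrC.
  have dl : is_derive t 1 (fun r => - c * r) (- c).
    apply: (is_derive_eq (is_deriveM_fun (is_derive_cst _ _ _) (is_derive_id t 1))).
    by rewrite mul0r add0r mulr1.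
  have de := is_derive1_comp (is_derive_expR (- c * t)) dl.
  apply: (is_derive_eq (is_deriveM_fun dg de)).
  by rewrite /=; ring.
have dh0 (t : R) : 0 <= t <= 1 ->
    (\sum_j y j t * dy j t * 2 - c * g t) * expR (- c * t) <= 0.
  move=> t01; rewrite pmulr_lle0 ?expR_gt0// subr_le0.
  apply: (@le_trans _ _ (`|C| * (\sum_j `|y j t|) ^+ 2 * 2)).
    rewrite -mulr_suml ler_wpM2r// expr2 mulrCA mulr_suml; apply: ler_sum => j _.
    apply: le_trans (ler_norm _) _; rewrite normrM ler_wpM2l//.
    apply: le_trans (dyC t t01 j) _; rewrite ler_wpM2r ?ler_norm// sumr_ge0//.
  have H : (\sum_j `|y j t|) ^+ 2 <= #|I|%:R * g t.
    apply: le_trans (sqr_sum_le _) _; rewrite ler_wpM2l//.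
    by apply: ler_sum => j _; rewrite real_normK// num_real.
  by have := ler_wpM2l (normr_ge0 C) H; rewrite /c; lra.
have h1 : h 1 <= h 0.
  apply: (@ler0_derive1_le_cc _ h 0 1) => //; rewrite ?in_itv /= ?lexx ?ler01//.
  - by move=> t; rewrite in_itv /= => /andP[/ltW t0 /ltW t1]; have [] := dh t; rewrite ?t0.
  - move=> t; rewrite in_itv /= => /andP[/ltW t0 /ltW t1].
    rewrite derive1E; have t01 : 0 <= t <= 1 by rewrite t0.
    by rewrite (@derive_val _ _ _ _ _ _ _ (dh t t01)) dh0.
  apply: derivable_within_continuous => t; rewrite in_itv /= => t01.
  by have [] := dh t t01.
have g1 : g 1 <= 0.
  move: h1; rewrite /h {2}/g big1 ?mul0r; last by move=> j _; rewrite y0 expr0n.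
  by rewrite pmulr_lle0 ?expR_gt0.
have : g 1 == 0 by rewrite eq_le g1 sumr_ge0// => j _; rewrite sqr_ge0.
rewrite psumr_eq0 => [/allP /(_ i (mem_index_enum i))|j _]; last exact: sqr_ge0.
by rewrite /= sqrf_eq0 => /eqP.
Qed.

(** * Propagation of zeros over a connected open set *)

Lemma open_box (R : realType) (D : set (R * R)) (p : R * R) :
  open D -> D p -> exists2 r : R, 0 < r &
    forall q, `|p.1 - q.1| < r -> `|p.2 - q.2| < r -> D q.
Proof.
move=> oD Dp; have /nbhs_ballP [r /= r0 rD] : nbhs p D by apply: open_nbhs_nbhs.
by exists r => // q q1 q2; apply: rD; split; rewrite -ball_normE.
Qed.

(** Continuity on the line only: the coefficients it is meant for are built from functions known to
    be differentiable in the single direction [v]. *)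
Definition continuous_along (R : realType) (K : numFieldType) (v : R * R)
  (f : R * R -> K) (p : R * R) : Prop := {for 0, continuous (fun t : R => f (p + t *: v))}.

(** On the compact segment the continuous coefficient [c] attains a maximum, which reduces the claim
    to the Gronwall estimate with a constant. *)
Lemma vanish_segment (R : realType) (I : finType) (y : I -> R * R -> R)
  (c : R * R -> R) (p v : R * R) (s : R) :
  (forall t : R, 0 <= t <= 1 -> let z := p + (t * s) *: v in
    (forall i, derivable (y i) z v /\
               `|'D_v (y i) z| <= c z * \sum_j `|y j z|) /\
    continuous_along v c z) ->
  (forall i, y i p = 0) -> forall i, y i (p + s *: v) = 0.
Proof.
move=> H y0 i.
have cc : {within `[(0 : R), 1], continuous (fun t : R => c (p + (t * s) *: v))}.
  apply: continuous_in_subspaceT => t; rewrite inE/= in_itv /= => /H [_ cz].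
  have E : (fun t : R => c (p + (t * s) *: v)) =
      (fun h : R => c (p + (t * s) *: v + h *: v)) \o (fun r : R => (r - t) * s).
    apply/funext => r /=; congr (c _); rewrite -addrA -scalerDl; congr (_ + _ *: _).
    by ring.
  rewrite E; apply: continuous_comp.
    apply: cvgMl; apply: cvgB; [exact: cvg_id|exact: cvg_cst].
  by rewrite subrr mul0r.
have [t0 t0I cmax] := EVT_max ler01 cc.
(* The factor [|s|] comes from reparametrizing the segment by the unit interval. *)
pose C := `|s| * c (p + (t0 * s) *: v).
rewrite -[s]mul1r.
apply: (@gronwall_eq0 _ _ (fun j t => y j (p + (t * s) *: v))
  (fun j t => 'D_v (y j) (p + (t * s) *: v) * s) C) => //.
- move=> t t01 j; have [/(_ j)[dy _] _] := H t t01.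
  exact/is_derive_segment/derivableP.
- move=> t t01 j; have [/(_ j)[_ yb] _] := H t t01.
  rewrite normrM mulrC /C -mulrA ler_wpM2l//.
  apply: le_trans yb _; rewrite ler_wpM2r ?sumr_ge0//.
  by apply: cmax; rewrite in_itv.
- by move=> j; rewrite mul0r scale0r addr0.
Qed.

(** Because the local hypothesis is an equivalence, both [Z] and its complement are open inside [D],
    so [Z] is relatively clopen there. *)
Lemma connected_propagation (R : realType) (D Z : set (R * R)) (p0 : R * R) :
  open D -> connected D -> D p0 -> Z p0 ->
  (forall p, D p -> exists2 U, nbhs p U &
     forall q, U q -> D q /\ (Z p <-> Z q)) ->
  D `<=` Z.
Proof.
move=> oD cD Dp0 Zp0 H.
have op (P : set (R * R)) : (forall p q, (Z p <-> Z q) -> P p -> P q) ->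
    open (D `&` P).
  move=> PE; rewrite openE => p [Dp Pp]; have [U Up UH] := H p Dp.
  by apply: filterS Up => q /UH [Dq E]; split=> //; exact: PE Pp.
have oZ : open (D `&` Z) by apply: op => p q [].
have oZc : open (D `&` ~` Z) by apply: op => p q E nZ /E.
suff <- : D `&` Z = D by move=> p [].
apply: cD; first by exists p0.
  by exists (D `&` Z); rewrite // setIA setIid.
exists (~` (D `&` ~` Z)); first exact: open_closedC.
apply/seteqP; split=> [p [Dp Zp]|p [Dp]]; first by split=> // -[].
by move=> nZ; split=> //; apply: contrapT => nZp; apply: nZ.
Qed.

(** The inequalities hold along the axes only, so a box around [p] is crossed by a horizontal
    segment followed by a vertical one; the same broken line run backwards gives the converse needed
    for the equivalence. *)
Lemma vanish_connected (R : realType) (I : finType) (D : set (R * R))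
  (y : I -> R * R -> R) (p0 : R * R) :
  open D -> connected D -> D p0 -> (forall i, y i p0 = 0) ->
  (forall v, v = xi_dir R \/ v = eta_dir R -> exists c : R * R -> R,
    forall p, D p ->
      (forall i, derivable (y i) p v /\
                 `|'D_v (y i) p| <= c p * \sum_j `|y j p|) /\
      continuous_along v c p) ->
  forall p, D p -> forall i, y i p = 0.
Proof.
move=> oD cD Dp0 y0 H.
have [cx Hx] := H _ (or_introl erefl); have [ce He] := H _ (or_intror erefl).
apply: (@connected_propagation _ D [set p | forall i, y i p = 0] p0) => //.
move=> p Dp; have [r r0 rD] := open_box oD Dp.
exists (ball p r); first exact: nbhsx_ballx.
move=> [x e] []; rewrite -!ball_normE /= => xr er; split; first exact: rD.
have conv (a b b' t : R) : `|a - b| < r -> `|a - b'| < r -> 0 <= t <= 1 ->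
    `|a - (b + t * (b' - b))| < r.
  move=> ab ab' /andP[t0 t1].
  have -> : a - (b + t * (b' - b)) = (1 - t) * (a - b) + t * (a - b') by ring.
  apply: le_lt_trans (ler_normD _ _) _.
  rewrite !normrM (ger0_norm t0) ger0_norm ?subr_ge0//.
  have [->|tn0] := eqVneq t 0; first by rewrite mul0r addr0 subr0 mul1r.
  have t_gt0 : 0 < t by rewrite lt0r tn0.
  have : (1 - t) * `|a - b| <= (1 - t) * r by rewrite ler_wpM2l ?subr_ge0// ltW.
  have : t * `|a - b'| < t * r by rewrite ltr_pM2l.
  lra.
have p1 : `|p.1 - p.1| < r by rewrite subrr normr0.
have p2 : `|p.2 - p.2| < r by rewrite subrr normr0.
have hor a b e' : `|p.1 - a| < r -> `|p.1 - b| < r -> `|p.2 - e'| < r ->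
    (forall i, y i (a, e') = 0) -> forall i, y i (b, e') = 0.
  move=> ar br er' ya i.
  have -> : (b, e') = (a, e') + (b - a) *: xi_dir R.
    by congr pair; rewrite /= /GRing.scale/= ?mulr1 ?mulr0; ring.
  apply: (@vanish_segment _ _ y cx) => // t t01; apply: Hx.
  apply: rD; rewrite /= /GRing.scale/= ?mulr1 ?mulr0 ?addr0//.
  exact: conv.
have ver a b e' : `|p.2 - a| < r -> `|p.2 - b| < r -> `|p.1 - e'| < r ->
    (forall i, y i (e', a) = 0) -> forall i, y i (e', b) = 0.
  move=> ar br er' ya i.
  have -> : (e', b) = (e', a) + (b - a) *: eta_dir R.
    by congr pair; rewrite /= /GRing.scale/= ?mulr1 ?mulr0; ring.
  apply: (@vanish_segment _ _ y ce) => // t t01; apply: He.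
  apply: rD; rewrite /= /GRing.scale/= ?mulr1 ?mulr0 ?addr0//.
  exact: conv.
rewrite [p]surjective_pairing; split=> yp.
  by apply: (ver p.2) => //; apply: (hor p.1).
by apply: (hor x) => //; apply: (ver e).
Qed.

(** A bootstrap on the first exit time [tau]. Up to [tau] the speed is at most [m], so the mean
    value theorem bounds the displacement at [tau] by [m] and the strict inequality still holds
    there; by continuity it holds slightly later, against the choice of [tau]. *)
Lemma trap_segment (R : realType) (I : finType) (z dz : I -> R -> R)
  (c : I -> R) (e m : R) : 0 <= m ->
  (forall t : R, 0 <= t <= 1 -> forall i, is_derive t 1 (z i) (dz i t)) ->
  (forall t : R, 0 <= t <= 1 -> (forall j, `|z j t - c j| < e) ->
     forall i, `|dz i t| <= m) ->
  (forall i, `|z i 0 - c i| + m < e) -> forall i, `|z i 1 - c i| < e.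
Proof.
move=> m0 dzz dzm z0 i.
apply: contrapT => /negP; rewrite -leNgt => bad.
pose B := [set t : R | 0 <= t <= 1 /\ exists j, e <= `|z j t - c j|].
have B1 : B 1 by split; [rewrite ler01 lexx | exists i].
have lB : has_lbound B by exists 0 => t [/andP[]].
have iB : has_inf B by split=> //; exists 1.
pose tau := inf B.
have tau0 : 0 <= tau by apply: lb_le_inf; [exists 1|move=> t [/andP[]]].
have tau1 : tau <= 1 by apply: ge_inf.
have good t : 0 <= t < tau -> forall j, `|z j t - c j| < e.
  move=> /andP[t0 tt] j; apply: contrapT => /negP; rewrite -leNgt => ej.
  suff : tau <= t by rewrite leNgt tt.
  by apply: ge_inf => //; split; [rewrite t0 (le_trans (ltW tt))|exists j].
have gtau j : `|z j tau - c j| < e.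
  apply: le_lt_trans (z0 j).
  have -> : z j tau - c j = (z j 0 - c j) + (z j tau - z j 0) by ring.
  apply: le_trans (ler_normD _ _) _; rewrite lerD2l.
  have [->|tn0] := eqVneq tau 0; first by rewrite subrr normr0.
  have t_gt0 : 0 < tau by rewrite lt0r tn0.
  have dx x : x \in `]0, tau[ -> is_derive x 1 (z j) (dz j x).
    by rewrite in_itv /= => /andP[x0 x1]; apply: dzz; rewrite ltW//= (le_trans (ltW x1)).
  have cx : {within `[0, tau], continuous (z j)}.
    apply: derivable_within_continuous => t; rewrite in_itv /= => /andP[t0 t1].
    by have [] := dzz t _ j; rewrite ?t0 ?(le_trans t1).
  have [x] := MVT t_gt0 dx cx.
  rewrite in_itv /= => /andP[x0 x1] ->; rewrite subr0 normrM (ger0_norm tau0).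
  apply: (@le_trans _ _ (m * 1)); last by rewrite mulr1.
  apply: ler_pM => //; apply: (dzm x) => [|k].
    by rewrite ltW//= (le_trans (ltW x1)).
  by apply: good; rewrite ltW.
have : \forall t \near tau, forall j, `|z j t - c j| < e.
  have F := (@filter_forall R I (fun j t => `|z j t - c j| < e) (nbhs tau) _).
  apply: F => j.
  have zc : {for tau, continuous (z j)}.
    apply: differentiable_continuous; apply/derivable1_diffP.
    by have [] := dzz tau _ j; rewrite ?tau0 ?tau1.
  have /cvgr_lt : `|z j t - c j| @[t --> tau] --> `|z j tau - c j|.
    by apply: cvg_norm; apply: cvgB; [exact: zc|exact: cvg_cst].
  by apply.
move=> /nbhs_ballP [d /= d0 dg].
have [b [/andP[b0 b1] [j ej]] bt] := inf_adherent d0 iB.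
have tb : tau <= b by apply: ge_inf => //; split; [rewrite b0 b1|exists j].
have bd : ball tau d b by rewrite -ball_normE /= distrC ger0_norm ?subr_ge0// ltrBlDl.
by have := dg b bd j; rewrite /= ltNge ej.
Qed.

(** A point near [p0] is reached vertically, then horizontally. The first move is controlled by the
    eta-derivative at [p0] alone; on the second, the bound [M] is available only while the values
    stay close to those at [p0], which is what trapping provides. *)
Lemma trap_continuous (R : realType) (I : finType) (y : I -> R * R -> R)
  (p0 : R * R) (r M : R) : 0 < r ->
  (forall p, `|p0.1 - p.1| < r -> `|p0.2 - p.2| < r ->
     (forall i, derivable (y i) p (xi_dir R)) /\
     ((forall j, `|y j p - y j p0| < r) ->
        forall i, `|'D_(xi_dir R) (y i) p| <= M)) ->
  (forall i, derivable (y i) p0 (eta_dir R)) ->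
  forall i, {for p0, continuous (y i)}.
Proof.
move=> r0 H dy i; apply/cvgrPdist_lt => e0 e0_gt0.
pose e := Num.min e0 r.
have e_gt0 : 0 < e by rewrite lt_min e0_gt0.
have ce : \forall h \near (0 : R), forall j,
    `|y j (p0 + h *: eta_dir R) - y j p0| < e / 2.
  have F := @filter_forall R I
    (fun j h => `|y j (p0 + h *: eta_dir R) - y j p0| < e / 2) (nbhs (0 : R)) _.
  apply: F => j.
  have : {for 0, continuous (fun h : R => y j (p0 + h *: eta_dir R))}.
    apply: differentiable_continuous; apply/derivable1_diffP.
    have := @is_derive_line _ _ (y j) p0 (eta_dir R) 0 ('D_(eta_dir R) (y j) p0).
    by rewrite scale0r addr0 => /(_ (derivableP (dy j))) [].
  move=> /cvgrPdist_lt /(_ (e / 2)); rewrite divr_gt0// => /(_ isT).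
  by apply: filterS => h; rewrite scale0r addr0 distrC.
move: ce => /nbhs_ballP [d /= d0 dg].
(* Half of [e] is spent on the vertical move; a horizontal move of length at most [m] costs at most
   [(|M| + 1) m = e / 2]. *)
pose m := e / 2 / (`|M| + 1).
have M1 : 0 < `|M| + 1 by rewrite ltr_wpDl.
have m0 : 0 < m by rewrite !divr_gt0.
change (nbhs p0 [set q | `|y i p0 - y i q| < e0]); apply/nbhs_ballP.
exists (Num.min (Num.min r m) (Num.min r d)).
  by rewrite /= !lt_min r0 m0 d0.
move=> q qb /=.
apply: (@lt_le_trans _ _ e); last by rewrite ge_min lexx.
have [q1 q2] : `|p0.1 - q.1| < Num.min r m /\ `|p0.2 - q.2| < Num.min r d.
  by case: qb; rewrite -!ball_normE /= !lt_min => /andP[/andP[-> ->] _] /andP[/andP[-> _] ->].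
rewrite !lt_min in q1 q2; move: q1 q2 => /andP[q1r q1m] /andP[q2r q2d].
have qE : q = (p0.1, q.2) + (1 * (q.1 - p0.1)) *: xi_dir R.
  rewrite [LHS]surjective_pairing; congr pair; rewrite /= /GRing.scale/=; ring.
pose path t := (p0.1, q.2) + (t * (q.1 - p0.1)) *: xi_dir R.
have pathr t : 0 <= t <= 1 ->
    `|p0.1 - (path t).1| < r /\ `|p0.2 - (path t).2| < r.
  move=> /andP[t0 t1]; rewrite /path /= /GRing.scale/= mulr1 mulr0 addr0; split=> //.
  have -> : p0.1 - (p0.1 + t * (q.1 - p0.1)) = t * (p0.1 - q.1) by ring.
  rewrite normrM ger0_norm//; apply: le_lt_trans q1r.
  by rewrite -[leRHS]mul1r ler_wpM2r.
rewrite distrC {1}qE.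
have T := @trap_segment _ _
  (fun j t => y j ((p0.1, q.2) + (t * (q.1 - p0.1)) *: xi_dir R))
  (fun j t => 'D_(xi_dir R) (y j) ((p0.1, q.2) + (t * (q.1 - p0.1)) *: xi_dir R)
      * (q.1 - p0.1)) (fun j => y j p0) e (e / 2).
apply: (T _ _ _ _ i) => {T}.
- by rewrite divr_ge0// ltW.
- move=> t t01 j.
  have [h1 h2] := pathr t t01; have [/(_ j) dyj _] := H (path t) h1 h2.
  exact/is_derive_segment/derivableP.
- move=> t t01 yr j; have [h1 h2] := pathr t t01; have [_ bd] := H (path t) h1 h2.
  rewrite normrM.
  apply: (@le_trans _ _ ((`|M| + 1) * m)).
    apply: ler_pM => //; last by rewrite distrC ltW.
    apply: le_trans (bd _ _) _.
      by move=> k; apply: (lt_le_trans (yr k)); rewrite ge_min lexx orbT.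
    by rewrite (le_trans (ler_norm _))// lerDl.
  by rewrite /m mulrCA divff ?mulr1// gt_eqF.
- move=> j; rewrite mul0r scale0r addr0 -ltrBrDr.
  have -> : e - e / 2 = e / 2 by field.
  have qd : ball (0 : R) d (q.2 - p0.2) by rewrite -ball_normE /= sub0r normrN distrC.
  have := dg (q.2 - p0.2) qd j.
  congr (`|y j _ - _| < _); rewrite [p0 in LHS]surjective_pairing.
  congr pair; rewrite /= /GRing.scale/=; ring.
Qed.

(** * Equality of mixed derivatives *)

Lemma cvg_dist_le (R : realType) (T : Type) (F : set_system T)
  (FF : ProperFilter F) (f : T -> R) (l L e : R) :
  f x @[x --> F] --> l -> (\forall x \near F, `|f x - L| <= e) -> `|l - L| <= e.
Proof.
move=> fl fL; apply/ler_addgt0Pr => e' e'0.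
move/cvgrPdist_lt : fl => /(_ e' e'0) fl.
have [x [flx fLx]] := filter_ex (filterI fl fL).
have -> : l - L = (f x - L) + (l - f x) by ring.
by apply: le_trans (ler_normD _ _) _; rewrite lerD// ltW.
Qed.

Lemma mvt_line (R : realType) (g dg : R -> R) :
  (forall t : R, 0 <= t <= 1 -> is_derive t 1 g (dg t)) ->
  exists2 c, 0 <= c <= 1 & g 1 - g 0 = dg c.
Proof.
move=> gdg.
have dx x : x \in `]0, (1 : R)[ -> is_derive x 1 g (dg x).
  by rewrite in_itv /= => /andP[x0 x1]; apply: gdg; rewrite !ltW.
have cx : {within `[0, (1 : R)], continuous g}.
  apply: derivable_within_continuous => t; rewrite in_itv /= => t01.
  by have [] := gdg t t01.
have [c] := MVT ltr01 dx cx; rewrite in_itv /= subr0 mulr1 => /andP[c0 c1] gE.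
by exists c; rewrite // !ltW.
Qed.

(* Only the mixed derivative [f_xi_eta] is assumed continuous: the double
   difference quotient is a value of it, and its iterated limit is
   [f_eta_xi]. *)
Lemma schwarz (R : realType) (E : set (R * R)) (f fx fe : R * R -> R)
  (p : R * R) : open E -> E p ->
  (forall z, E z -> is_derive z (xi_dir R) f (fx z)) ->
  (forall z, E z -> is_derive z (eta_dir R) f (fe z)) ->
  (forall z, E z -> derivable fx z (eta_dir R)) ->
  {for p, continuous ('D_(eta_dir R) fx)} ->
  derivable fe p (xi_dir R) ->
  'D_(eta_dir R) fx p = 'D_(xi_dir R) fe p.
Proof.
move=> oE Ep fxE feE dfx cdfx dfe; set L := LHS.
have [r0 r0_gt0 rE] := open_box oE Ep.
suff H : forall e, 0 < e -> `|'D_(xi_dir R) fe p - L| <= e.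
  apply/esym/eqP; rewrite -subr_eq0 -normr_eq0 eq_le normr_ge0 andbT.
  by apply/ler_addgt0Pr => e e0; rewrite add0r; exact: H.
move=> e e_gt0.
have /nbhs_ballP [r1 r1_gt0 r1E] : nbhs p [set z | `|L - 'D_(eta_dir R) fx z| < e].
  by move/cvgrPdist_lt : cdfx; apply.
pose r := Num.min r0 r1.
have r_gt0 : 0 < r by rewrite lt_min r0_gt0.
have rsub (a b s t : R) : `|a| < r -> `|b| < r -> 0 <= s <= 1 -> 0 <= t <= 1 ->
    let z := p + (s * a) *: xi_dir R + (t * b) *: eta_dir R in
    E z /\ `|L - 'D_(eta_dir R) fx z| < e.
  move=> ar br /andP[s0 s1] /andP[t0 t1] z.
  have le1 (s' a' : R) : 0 <= s' -> s' <= 1 -> `|a'| < r -> `|s' * a'| < r.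
    move=> s0' s1'; apply: le_lt_trans; rewrite normrM ger0_norm//.
    by rewrite -[leRHS]mul1r ler_wpM2r.
  have z1 : `|p.1 - z.1| < r.
    have -> : p.1 - z.1 = - (s * a) by rewrite /z /= /GRing.scale/=; ring.
    by rewrite normrN; exact: le1.
  have z2 : `|p.2 - z.2| < r.
    have -> : p.2 - z.2 = - (t * b) by rewrite /z /= /GRing.scale/=; ring.
    by rewrite normrN; exact: le1.
  move: z1 z2; rewrite !lt_min => /andP[z1 z1'] /andP[z2 z2']; split.
    exact: rE.
  by apply: r1E; split; rewrite -ball_normE.
(* Mean value theorem twice: along xi for the difference of [f] on two parallel horizontal segments,
   then along eta for [fx]. *)
have diff2 h k : `|h| < r -> `|k| < r -> exists2 z,
    `|L - 'D_(eta_dir R) fx z| < e &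
    (f (p + h *: xi_dir R + k *: eta_dir R) - f (p + h *: xi_dir R))
     - (f (p + k *: eta_dir R) - f p) = h * k * 'D_(eta_dir R) fx z.
  move=> hr kr.
  have d1 (t : R) : 0 <= t <= 1 -> is_derive t 1
    (fun t => f (p + k *: eta_dir R + (t * h) *: xi_dir R)
              - f (p + (t * h) *: xi_dir R))
    (fx (p + k *: eta_dir R + (t * h) *: xi_dir R) * h
              - fx (p + (t * h) *: xi_dir R) * h).
    move=> t01; have i1 : 0 <= (1 : R) <= 1 by rewrite lexx ler01.
    have i0 : 0 <= (0 : R) <= 1 by rewrite lexx ler01.
    have [E1 _] := rsub h k t 1 hr kr t01 i1.
    have [E0 _] := rsub h k t 0 hr kr t01 i0.
    rewrite mul0r scale0r addr0 in E0; rewrite mul1r addrAC in E1.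
    apply: is_deriveB; first exact/is_derive_segment/fxE.
    exact/is_derive_segment/fxE.
  have [s s01 sE] := mvt_line d1.
  have d2 (t : R) : 0 <= t <= 1 -> is_derive t 1
    (fun t => fx (p + (s * h) *: xi_dir R + (t * k) *: eta_dir R))
    ('D_(eta_dir R) fx (p + (s * h) *: xi_dir R + (t * k) *: eta_dir R) * k).
    move=> t01; apply: is_derive_segment; apply: derivableP; apply: dfx.
    by have [] := rsub h k s t hr kr s01 t01.
  have [t t01 tE] := mvt_line d2.
  exists (p + (s * h) *: xi_dir R + (t * k) *: eta_dir R).
    by have [] := rsub h k s t hr kr s01 t01.
  move: sE; rewrite !mul1r !mul0r !scale0r !addr0 -mulrBl.
  rewrite [p + _ + h *: _]addrAC [p + _ + (s * h) *: _]addrAC.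
  move: tE; rewrite mul1r mul0r scale0r addr0 => -> ->; ring.
apply: (@cvg_dist_le R R (0 : R)^' _ _ _ L e dfe).
near=> h.
have hr : `|h| < r by near: h; exact: dnbhs0_lt.
have h0 : h != 0 by near: h; exact: nbhs_dnbhs_neq.
rewrite /= [h *: _ + p]addrC.
(* The inner limit is taken first: for fixed [h], dividing the double difference by [k] and letting
   [k] tend to 0 produces the increment of [fe]. *)
suff H : `|(fe (p + h *: xi_dir R) - fe p) - L * h| <= e * `|h|.
  have -> : h^-1 *: (fe (p + h *: xi_dir R) - fe p) - L =
      (fe (p + h *: xi_dir R) - fe p - L * h) / h.
    by rewrite /GRing.scale /=; field.
  by rewrite normrM normfV ler_pdivrMr// normr_gt0.
have Eh : E (p + h *: xi_dir R).
  have i1 : 0 <= (1 : R) <= 1 by rewrite lexx ler01.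
  have r00 : `|0 : R| < r by rewrite normr0.
  have [] := rsub h 0 1 1 hr r00 i1 i1.
  by rewrite !mul1r scale0r addr0.
have [dk1 dk2] := feE _ Eh.
have [dk3 dk4] := feE _ Ep.
have dk := @cvgB _ _ _ (0 : R)^' (dnbhs_filter _) _ _ _ _ dk1 dk3.
rewrite -dk2 -dk4; apply: (@cvg_dist_le R R (0 : R)^' _ _
  ('D_(eta_dir R) f (p + h *: xi_dir R) - 'D_(eta_dir R) f p) _ _ dk).
near=> k.
have kr : `|k| < r by near: k; exact: dnbhs0_lt.
have k0 : k != 0 by near: k; exact: nbhs_dnbhs_neq.
have [z zL zE] := diff2 h k hr kr.
change (`|k^-1 *: (f (k *: eta_dir R + (p + h *: xi_dir R)) - f (p + h *: xi_dir R))
  - k^-1 *: (f (k *: eta_dir R + p) - f p) - L * h| <= e * `|h|).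
rewrite -scalerBr ![k *: _ + _]addrC zE.
have -> : k^-1 *: (h * k * 'D_(eta_dir R) fx z) - L * h =
    - ((L - 'D_(eta_dir R) fx z) * h) by rewrite /GRing.scale /=; field.
by rewrite normrN normrM ler_wpM2r// ltW.
Unshelve. all: by end_near. Qed.

(** * Function classes closed under field operations *)

(** One interface for joint continuity, derivability along a direction, [partial_C1] and continuity
    along lines; the regularity of a matrix expression is then proved once for all of them. *)
Record field_closed (K : fieldType) (T : Type) (U : set T)
  (P : (T -> K) -> Prop) : Prop := FieldClosed {
  fclosed_cst : forall k, P (fun=> k);
  fclosedD : forall f g, P f -> P g -> P (fun t => f t + g t);
  fclosedM : forall f g, P f -> P g -> P (fun t => f t * g t);
  fclosedV : forall f, P f -> (forall t, U t -> f t != 0) -> P (fun t => (f t)^-1);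
  fclosed_ext : forall f g, {in U, f =1 g} -> P f -> P g
}.

Definition entrywise (K : Type) (T : Type) (P : (T -> K) -> Prop) (m n : nat)
  (F : T -> 'M[K]_(m, n)) : Prop := forall i j, P (fun t => F t i j).

Section Entrywise.
Variables (K : fieldType) (T : Type) (U : set T) (P : (T -> K) -> Prop).
Hypothesis HP : field_closed U P.

Lemma fclosedN f : P f -> P (fun t => - f t).
Proof.
move=> Pf; have := fclosedM HP (fclosed_cst HP (-1)) Pf.
by apply: (fclosed_ext HP) => // t _; rewrite mulN1r.
Qed.

Lemma fclosed_sum (I : Type) (r : seq I) (Q : pred I) (f : I -> T -> K) :
  (forall i, P (f i)) -> P (fun t => \sum_(i <- r | Q i) f i t).
Proof.
move=> Pf; elim: r => [|i r IH].
  by apply: (fclosed_ext HP _ (fclosed_cst HP 0)) => // t _; rewrite big_nil.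
have [Qi|nQi] := boolP (Q i).
  by apply: (fclosed_ext HP _ (fclosedD HP (Pf i) IH)) => // t _; rewrite big_cons Qi.
by apply: (fclosed_ext HP _ IH) => // t _; rewrite big_cons (negPf nQi).
Qed.

Lemma fclosed_prod (I : Type) (r : seq I) (f : I -> T -> K) :
  (forall i, P (f i)) -> P (fun t => \prod_(i <- r) f i t).
Proof.
move=> Pf; elim: r => [|i r IH].
  by apply: (fclosed_ext HP _ (fclosed_cst HP 1)) => // t _; rewrite big_nil.
by apply: (fclosed_ext HP _ (fclosedM HP (Pf i) IH)) => // t _; rewrite big_cons.
Qed.

Lemma entrywise_cst m n (M : 'M[K]_(m, n)) : entrywise P (fun=> M).
Proof. by move=> i j; exact: (fclosed_cst HP). Qed.

Lemma entrywiseD m n (F G : T -> 'M[K]_(m, n)) :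
  entrywise P F -> entrywise P G -> entrywise P (fun t => F t + G t).
Proof.
move=> PF PG i j; apply: (fclosed_ext HP _ (fclosedD HP (PF i j) (PG i j))) => // t _.
by rewrite mxE.
Qed.

Lemma entrywiseZ m n (f : T -> K) (F : T -> 'M[K]_(m, n)) :
  P f -> entrywise P F -> entrywise P (fun t => f t *: F t).
Proof.
move=> Pf PF i j; apply: (fclosed_ext HP _ (fclosedM HP Pf (PF i j))) => // t _.
by rewrite mxE.
Qed.

Lemma entrywiseN m n (F : T -> 'M[K]_(m, n)) :
  entrywise P F -> entrywise P (fun t => - F t).
Proof.
move=> PF i j; apply: (fclosed_ext HP _ (fclosedN (PF i j))) => // t _.
by rewrite mxE.
Qed.

Lemma entrywiseB m n (F G : T -> 'M[K]_(m, n)) :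
  entrywise P F -> entrywise P G -> entrywise P (fun t => F t - G t).
Proof. by move=> PF PG; apply: entrywiseD => //; exact: entrywiseN. Qed.

Lemma entrywise_tr m n (F : T -> 'M[K]_(m, n)) :
  entrywise P F -> entrywise P (fun t => (F t)^T).
Proof.
by move=> PF i j; apply: (fclosed_ext HP _ (PF j i)) => // t _; rewrite mxE.
Qed.

Lemma entrywiseM m n p (F : T -> 'M[K]_(m, n)) (G : T -> 'M[K]_(n, p)) :
  entrywise P F -> entrywise P G -> entrywise P (fun t => F t *m G t).
Proof.
move=> PF PG i j.
have := @fclosed_sum _ (index_enum _) xpredT (fun k t => F t i k * G t k j).
move=> /(_ (fun k => fclosedM HP (PF i k) (PG k j))).
by apply: (fclosed_ext HP) => // t _; rewrite mxE.
Qed.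

Lemma fclosed_det n (F : T -> 'M[K]_n) :
  entrywise P F -> P (fun t => \det (F t)).
Proof.
move=> PF; apply: fclosed_sum => s; apply: (fclosedM HP).
  exact: (fclosed_cst HP).
exact: fclosed_prod.
Qed.

(** Cramer's rule: each entry of the inverse is a minor, up to sign, divided by the determinant. *)
Lemma entrywise_inv n (F : T -> 'M[K]_n) : (forall t, U t -> F t \in unitmx) ->
  entrywise P F -> entrywise P (fun t => invmx (F t)).
Proof.
move=> UF PF i j.
have Pd : P (fun t => (\det (F t))^-1).
  apply: (fclosedV HP); first exact: fclosed_det.
  by move=> t /UF; rewrite unitmxE unitfE.
have Pc : P (fun t => (-1) ^+ (j + i) * \det (row' j (col' i (F t)))).
  apply: (fclosedM HP); first exact: (fclosed_cst HP).
  by apply: fclosed_det => k l; apply: (fclosed_ext HP _ (PF _ _)) => // t _; rewrite !mxE.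
apply: (fclosed_ext HP _ (fclosedM HP Pd Pc)) => // t; rewrite inE => Ut.
by rewrite /invmx UF// !mxE.
Qed.

End Entrywise.

(** * Classes of continuous and of partially differentiable functions *)

Definition continuous_on (K : numFieldType) (T : topologicalType) (U : set T)
  (f : T -> K) : Prop := forall t, U t -> {for t, continuous f}.

Lemma continuous_on_closed (K : numFieldType) (T : topologicalType) (U : set T) :
  open U -> field_closed U (@continuous_on K T U).
Proof.
move=> oU; split=> [k|f g cf cg|f g cf cg|f cf f0|f g fg cf] t Ut.
- exact: cst_continuous.
- by apply: cvgD; [exact: cf|exact: cg].
- by apply: cvgM; [exact: cf|exact: cg].
- by apply: cvgV; [exact: f0|exact: cf].
- have E : \near t, f t = g t.
    by have := open_nbhs_nbhs (conj oU Ut); apply: filterS => s Us; apply: fg; rewrite inE.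
  change (g x @[x --> t] --> g t); rewrite -fg ?inE//.
  by apply: cvg_trans (cf t Ut); exact: near_eq_cvg.
Qed.

Section Derivable.
Variables (R : realType) (v : R * R) (U : set (R * R)).
Hypothesis oU : open U.

Lemma open_near_eq (f g : R * R -> R) p :
  {in U, f =1 g} -> U p -> {near p, f =1 g}.
Proof.
move=> fg Up; have := open_nbhs_nbhs (conj oU Up).
by apply: filterS => z Uz; apply: fg; rewrite inE.
Qed.

Lemma derivable_closed :
  field_closed U (fun f : R * R -> R => forall p, U p -> derivable f p v).
Proof.
split=> [k|f g df dg|f g df dg|f df f0|f g fg df] p Up.
- exact: derivable_cst.
- by apply: derivableD; [exact: df|exact: dg].
- by apply: derivableM; [exact: df|exact: dg].
- by apply: derivableV; [exact: f0|exact: df].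
- exact: near_eq_derivable (open_near_eq fg Up) (df p Up).
Qed.

(** Joint continuity of [f] is part of the class: it does not follow from one directional
    derivative, and the product rule brings [f] itself into the derivative. *)
Definition partial_C1 (f : R * R -> R) : Prop := forall p, U p ->
  [/\ {for p, continuous f}, derivable f p v & {for p, continuous ('D_v f)}].

Lemma partial_C1_closed : field_closed U partial_C1.
Proof.
have ext (f g : R * R -> R) p : {in U, f =1 g} -> {for p, continuous f} ->
    U p -> {for p, continuous g}.
  move=> fg cf Up; change (g x @[x --> p] --> g p); rewrite -fg ?inE//.
  by apply: cvg_trans cf; apply: near_eq_cvg; exact: open_near_eq.
split=> [k|f g Hf Hg|f g Hf Hg|f Hf f0|f g fg Hf] p Up.
- split; [exact: cst_continuous|exact: derivable_cst|].
  have -> : 'D_v (fun=> k) = (fun=> 0) :> (R * R -> R).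
    by apply/funext => z; rewrite derive_cst.
  exact: cst_continuous.
- have [cf df cdf] := Hf p Up; have [cg dg cdg] := Hg p Up.
  split; [exact: cvgD|exact: derivableD|].
  have c1 : {for p, continuous (fun z => 'D_v f z + 'D_v g z)}.
    by apply: cvgD; [exact: cdf|exact: cdg].
  apply: (ext _ _ _ _ c1 Up).
  move=> z; rewrite inE => Uz; have [_ dfz _] := Hf z Uz; have [_ dgz _] := Hg z Uz.
  by rewrite deriveD.
- have [cf df cdf] := Hf p Up; have [cg dg cdg] := Hg p Up.
  split; first exact: (@cvgM R _ (nbhs p) _ f g _ _ cf cg).
    by case: (is_deriveM_fun (derivableP df) (derivableP dg)).
  apply: (ext (fun z => 'D_v f z * g z + f z * 'D_v g z)) => //.
    move=> z; rewrite inE => Uz; have [_ dfz _] := Hf z Uz; have [_ dgz _] := Hg z Uz.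
    by rewrite (@derive_val _ _ _ _ _ _ _ (is_deriveM_fun (derivableP dfz) (derivableP dgz))).
  have c1 := @cvgM R _ (nbhs p) _ _ _ _ _ cdf cg.
  have c2 := @cvgM R _ (nbhs p) _ _ _ _ _ cf cdg.
  by apply: cvgD; [exact: c1|exact: c2].
- have [cf df cdf] := Hf p Up.
  split; [by apply: cvgV => //; exact: f0|by apply: derivableV => //; exact: f0|].
  apply: (ext (fun z => - (f z * f z)^-1 * 'D_v f z)) => //.
    move=> z; rewrite inE => Uz; have [_ dfz _] := Hf z Uz.
    by rewrite deriveV// ?f0// exprVn expr2.
  apply: cvgM => //; apply: cvgN; apply: cvgV; first by rewrite mulf_neq0// f0.
  exact: cvgM.
- have [cf df cdf] := Hf p Up; split; first exact: (ext f).
    exact: near_eq_derivable (open_near_eq fg Up) df.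
  apply: (ext ('D_v f)) => // z; rewrite inE => Uz.
  by apply: near_eq_derive; exact: open_near_eq.
Qed.

End Derivable.

(** * Algebra of the Darboux matrix *)

Lemma mulZmx (F : comNzRingType) m n p (k : F) (M : 'M[F]_(m, n)) (N : 'M[F]_(n, p)) :
  (k *: M) *m N = k *: (M *m N).
Proof. by rewrite scalemxAl. Qed.

Lemma mulmxZ (F : comNzRingType) m n p (k : F) (M : 'M[F]_(m, n)) (N : 'M[F]_(n, p)) :
  M *m (k *: N) = k *: (M *m N).
Proof. by rewrite scalemxAr. Qed.

Definition mx_expand := (@mulmxDl, @mulmxDr, @mulmxN, @mulNmx, @mulZmx, @mulmxZ,
  @mulmx1, @mul1mx, @mul_scalar_mx, @mul_mx_scalar, @mulmxA).

Lemma mxDE (F : nmodType) m n (M N : 'M[F]_(m, n)) i j :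
  (M + N) i j = M i j + N i j.
Proof. by rewrite mxE. Qed.

Lemma mxNE (F : zmodType) m n (M : 'M[F]_(m, n)) i j : (- M) i j = - M i j.
Proof. by rewrite mxE. Qed.

Lemma mxZE (F : pzRingType) m n (k : F) (M : 'M[F]_(m, n)) i j :
  (k *: M) i j = k * M i j.
Proof. by rewrite mxE. Qed.

Lemma mx0E (F : nmodType) m n i j : (0 : 'M[F]_(m, n)) i j = 0.
Proof. by rewrite mxE. Qed.

(** Meant for use after [mx_expand]: the left-associated products are atoms for [ring], so it
    decides identities linear in such products. *)
Ltac mx_linear := apply/matrixP => ? ?; rewrite ?(mxDE, mxNE, mxZE, mx0E); ring.

Lemma trmxD (F : nmodType) m n (M N : 'M[F]_(m, n)) : (M + N)^T = M^T + N^T.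
Proof. by apply/matrixP => i j; rewrite !mxE. Qed.

Lemma trmxN (F : zmodType) m n (M : 'M[F]_(m, n)) : (- M)^T = - M^T.
Proof. by apply/matrixP => i j; rewrite !mxE. Qed.

Lemma trmxZ (F : pzRingType) m n (k : F) (M : 'M[F]_(m, n)) : (k *: M)^T = k *: M^T.
Proof. by apply/matrixP => i j; rewrite !mxE. Qed.

(** Three substitutions suffice: [A B = 1 - s B], its transpose, and [K q^T = - q K]. What remains
    cancels linearly, so the defect of the Sylvester identity has derivative exactly zero. *)
Lemma sylvester_algebra (F : comNzRingType) (n m : nat) (s a : F)
    (A B S : 'M[F]_n) (P : 'M[F]_(n, m)) (q K : 'M[F]_m) :
  A *m B = 1%:M - s *: B -> q *m K = - (K *m q^T) ->
  let dA := - a *: A + (2 * a * s) *: 1%:M - (2 * a) *: B in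
  let dP := B *m P *m q in
  let dS := a *: (S - 2 *: (B *m S *m B^T)) - B *m P *m q *m K *m P^T *m B^T in
  (dA *m S + A *m dS) - (dS *m A^T + S *m dA^T) -
    (dP *m K *m P^T + P *m K *m dP^T) = 0.
Proof.
move=> AB qK.
have BA : B^T *m A^T = 1%:M - s *: B^T.
  by rewrite -trmx_mul AB trmxD trmxN trmxZ trmx1.
have Kq : K *m q^T = - (q *m K) by rewrite qK opprK.
rewrite /= !(trmx_mul, trmxD, trmxN, trmxZ, trmx1).
rewrite !mx_expand -!(mulmxA _ B^T A^T) BA AB.
rewrite -!(mulmxA _ K q^T) Kq !mx_expand; mx_linear.
Qed.


(* The matrix Q1 of the header: H is chosen so that 1 + H P inverts 1 - G B P. *)
Definition darboux_potential (F : fieldType) (n m : nat) (a : F)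
  (B : 'M[F]_n) (P : 'M[F]_(n, m)) (G H : 'M[F]_(m, n)) (q : 'M[F]_m) : 'M[F]_m :=
  (1%:M - G *m B *m P) *m q *m (1%:M + H *m P)
  - (2 * a) *: (G *m B *m B *m P *m (1%:M + H *m P)).

Section DarbouxAlgebra.
Variables (F : fieldType) (n m : nat) (s a : F).
Variables (A B C S X : 'M[F]_n) (P : 'M[F]_(n, m)) (q K : 'M[F]_m).
Variables (G H : 'M[F]_(m, n)).
Hypothesis ss : s * s = 1.
Hypotheses (BA : B *m (A + s%:M) = 1%:M) (CA : C *m A = 1%:M).
Hypothesis SX : S *m X = 1%:M.
Hypothesis ASA : A *m S - S *m A^T = P *m K *m P^T.
Hypothesis qK : q *m K = - (K *m q^T).
Hypotheses (GE : G = K *m P^T *m X) (HE : H = K *m P^T *m B^T *m X).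

Variable Q : 'M[F]_m.
Hypothesis QE : Q = darboux_potential a B P G H q.

Let XS : X *m S = 1%:M. Proof. exact: mulmx1C. Qed.

(** Multiply [(A + s) S - S (A^T + s) = P K P^T], where the shift cancels, by [B] on the left and
    [B^T] on the right. *)
Let SB : S *m B^T = B *m S + B *m P *m K *m P^T *m B^T.
Proof.
have BAt : (A^T + s%:M) *m B^T = 1%:M.
  by rewrite -[s%:M]tr_scalar_mx -raddfD /= -trmx_mul BA trmx1.
have -> : B *m P *m K *m P^T *m B^T = B *m (P *m K *m P^T) *m B^T.
  by rewrite !mulmxA.
have -> : P *m K *m P^T = (A + s%:M) *m S - S *m (A^T + s%:M).
  by rewrite -ASA !mx_expand; mx_linear.
have -> : B *m ((A + s%:M) *m S - S *m (A^T + s%:M)) *m B^T =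
   (B *m (A + s%:M)) *m S *m B^T - B *m S *m ((A^T + s%:M) *m B^T).
  by rewrite mulmxBr mulmxBl !mulmxA.
by rewrite BA BAt mul1mx mulmx1 addrC subrK.
Qed.

(** Moving [B^T] across [S] by [SB] gives [(1 - G B P) H = G B]; this is what makes [1 + H P] the
    inverse of [1 - G B P]. *)
Let wH : H = G *m B + G *m B *m P *m H.
Proof.
rewrite {1}HE.
have -> : K *m P^T *m B^T *m X = G *m (S *m B^T) *m X.
  by rewrite GE !mulmxA -[K *m P^T *m X *m S]mulmxA XS mulmx1.
by rewrite SB mulmxDr mulmxDl -!mulmxA SX mulmx1 HE !mulmxA.
Qed.

Let w'w : (1%:M + H *m P) *m (1%:M - G *m B *m P) = 1%:M.
Proof.
apply: mulmx1C; rewrite !mx_expand.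
rewrite {1}wH !mx_expand; mx_linear.
Qed.

Let w'GB : (1%:M + H *m P) *m (G *m B) = H.
Proof.
have -> : G *m B = (1%:M - G *m B *m P) *m H.
  by apply/esym/eqP; rewrite mulmxBl mul1mx subr_eq -wH.
by rewrite mulmxA w'w mul1mx.
Qed.

(** With [w = 1 - G B P], this is [Q w = w q - 2 a G B^2 P] solved for [Q G B P]. *)
Let QGBP : Q *m G *m B *m P =
  Q - q + G *m B *m P *m q + (2 * a) *: (G *m B *m B *m P).
Proof.
have : Q *m (1%:M - G *m B *m P) =
    (1%:M - G *m B *m P) *m q - (2 * a) *: (G *m B *m B *m P).
  rewrite QE /darboux_potential [LHS]mulmxBl mulZmx.
  by rewrite -![_ *m (1%:M + H *m P) *m _]mulmxA w'w !mulmx1.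
rewrite !mx_expand => /eqP; rewrite subr_eq => /eqP QwE.
by rewrite {2}QwE; mx_linear.
Qed.

Let QGB : Q *m G *m B = q *m H - G *m B *m P *m q *m H
  - (2 * a) *: (G *m B *m B *m P *m H).
Proof.
rewrite -mulmxA QE /darboux_potential [LHS]mulmxBl mulZmx.
rewrite -![_ *m (1%:M + H *m P) *m _]mulmxA w'GB.
by rewrite !mx_expand.
Qed.

Let dA := - a *: A + (2 * a * s) *: 1%:M - (2 * a) *: B.
Let dP := B *m P *m q.
Let dS := a *: (S - 2 *: (B *m S *m B^T)) - B *m P *m q *m K *m P^T *m B^T.
Let dC := - (C *m dA *m C).
Let dX := - (X *m dS *m X).
Let dG := K *m dP^T *m X + K *m P^T *m dX.

(** The derivative of [P] contributes [- q H] by the skewness of [q], and the term of [dS] in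
    [B S B^T] is reduced by [SB]; the terms ending in [H] then assemble into [- Q G B]. *)
Let dGE : dG = - (Q *m G *m B) - a *: G + (2 * a) *: (G *m B *m B).
Proof.
have e1 : K *m dP^T *m X = - (q *m H).
  rewrite /dP !trmx_mul !mulmxA -[K *m q^T]opprK -qK HE.
  by rewrite !mulNmx !mulmxA.
have e2 : K *m P^T *m dX =
    - (a *: G - (2 * a) *: (G *m B *m (S *m B^T) *m X) - G *m B *m P *m q *m H).
  have KS : K *m P^T *m X *m S *m X = G by rewrite -mulmxA SX mulmx1 GE.
  by rewrite /dX mulmxN /dS HE !mx_expand KS GE ?mulmxA; mx_linear.
have e3 : G *m B *m (S *m B^T) *m X = G *m B *m B + G *m B *m B *m P *m H.
  by rewrite SB !mx_expand -[_ *m S *m X]mulmxA SX mulmx1 HE !mulmxA.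
rewrite QGB /dG e1 e2 e3; mx_linear.
Qed.

(** Substituting [QGBP] cancels every explicit term in [B]. *)
Lemma darboux_deriv_product : dG *m P + G *m dP = q - Q - a *: (G *m P).
Proof. by rewrite dGE /dP !mx_expand QGBP; mx_linear. Qed.

(** [A] and [A + s] differ by a scalar with [1 / s = s], so their inverses satisfy
    [C B = B C = s (C - B)]. This splits all mixed products, after which [QGBP] applies. *)
Lemma darboux_deriv :
  - (dG *m C *m P + G *m dC *m P + G *m C *m dP) =
  s *: ((1%:M - G *m C *m P) *m q - Q *m (1%:M - G *m C *m P)).
Proof.
have AC : A *m C = 1%:M by exact: mulmx1C.
have AB : (A + s%:M) *m B = 1%:M by exact: mulmx1C.
have CB : C *m B = s *: (C - B).
  have h : B + s *: (C *m B) = C.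
    by rewrite -[RHS]mulmx1 -AB !mx_expand CA mul1mx.
  by rewrite -{2}h addrAC subrr add0r scalerA ss scale1r.
have BC : B *m C = s *: (C - B).
  have h : B + s *: (B *m C) = C.
    by rewrite -[RHS]mul1mx -BA !mx_expand -[B *m A *m C]mulmxA AC mulmx1.
  by rewrite -{2}h addrAC subrr add0r scalerA ss scale1r.
have s2 z : s * (s * z) = z by rewrite mulrA ss mul1r.
(* The two terms in [C^2], one from the constant term of [dA] and one from its resolvent term,
   cancel by the resolvent identity. *)
have dCE : dC = a *: C - (2 * a) *: (C - B).
  rewrite /dC /dA !mx_expand CA mul1mx CB !mx_expand BC.
  apply/matrixP => i j; rewrite !(mxDE, mxNE, mxZE).
  transitivity (a * C i j - 2 * a * (s * s) * (C i j - B i j)); first by ring.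
  by rewrite ss mulr1; ring.
rewrite dGE dCE /dP !mx_expand -!(mulmxA _ B C) BC -!(mulmxA _ C B) CB !mx_expand QGBP.
rewrite -!(mulmxA _ B C) BC !mx_expand.
apply/matrixP => i j; rewrite !(mxDE, mxNE, mxZE).
by rewrite [s * (s * _ - _)]mulrBr s2; ring.
Qed.

End DarbouxAlgebra.

(** * Derivatives of matrix functions *)

Definition is_mxderive (R : realType) (m n : nat) (v : R * R)
  (F : R * R -> 'M[R]_(m, n)) (p : R * R) (G : 'M[R]_(m, n)) : Prop :=
  forall i j, is_derive p v (fun z => F z i j) (G i j).

Section MatrixDerivative.
Variables (R : realType) (v p : R * R).

Lemma is_mxderive_eq m n (F : R * R -> 'M[R]_(m, n)) G G' :
  is_mxderive v F p G -> G = G' -> is_mxderive v F p G'.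
Proof. by move=> dF <-. Qed.

Lemma is_mxderive_unique m n (F : R * R -> 'M[R]_(m, n)) G G' :
  is_mxderive v F p G -> is_mxderive v F p G' -> G = G'.
Proof.
by move=> d1 d2; apply/matrixP => i j; have [_ <-] := d1 i j; have [_ <-] := d2 i j.
Qed.

Lemma is_mxderive_near m n (F F' : R * R -> 'M[R]_(m, n)) G :
  (\forall z \near p, F z = F' z) -> is_mxderive v F p G -> is_mxderive v F' p G.
Proof.
move=> FF' dF i j; apply: near_eq_is_derive (dF i j).
by apply: filterS FF' => z ->.
Qed.

Lemma is_mxderive_cst m n (M : 'M[R]_(m, n)) : is_mxderive v (fun=> M) p 0.
Proof. by move=> i j; rewrite mxE; exact: is_derive_cst. Qed.

Lemma is_mxderiveD m n (F F' : R * R -> 'M[R]_(m, n)) G G' :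
  is_mxderive v F p G -> is_mxderive v F' p G' ->
  is_mxderive v (fun z => F z + F' z) p (G + G').
Proof.
move=> dF dF' i j; rewrite mxE.
under eq_fun do rewrite mxE.
exact: is_deriveD_fun.
Qed.

Lemma is_mxderiveN m n (F : R * R -> 'M[R]_(m, n)) G :
  is_mxderive v F p G -> is_mxderive v (fun z => - F z) p (- G).
Proof.
move=> dF i j; rewrite mxE; under eq_fun do rewrite mxE.
exact: is_deriveN.
Qed.

Lemma is_mxderiveB m n (F F' : R * R -> 'M[R]_(m, n)) G G' :
  is_mxderive v F p G -> is_mxderive v F' p G' ->
  is_mxderive v (fun z => F z - F' z) p (G - G').
Proof. by move=> dF dF'; apply: is_mxderiveD => //; exact: is_mxderiveN. Qed.

Lemma is_mxderive_tr m n (F : R * R -> 'M[R]_(m, n)) G :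
  is_mxderive v F p G -> is_mxderive v (fun z => (F z)^T) p G^T.
Proof. by move=> dF i j; rewrite mxE; under eq_fun do rewrite mxE. Qed.

Lemma is_mxderiveZ m n (f : R * R -> R) (F : R * R -> 'M[R]_(m, n)) df G :
  is_derive p v f df -> is_mxderive v F p G ->
  is_mxderive v (fun z => f z *: F z) p (df *: F p + f p *: G).
Proof.
move=> dfp dF i j; rewrite !mxE; under eq_fun do rewrite mxE.
exact: is_deriveM_fun.
Qed.

Lemma is_mxderiveM m n l (F : R * R -> 'M[R]_(m, n)) (F' : R * R -> 'M[R]_(n, l)) G G' :
  is_mxderive v F p G -> is_mxderive v F' p G' ->
  is_mxderive v (fun z => F z *m F' z) p (G *m F' p + F p *m G').
Proof.
move=> dF dF' i j; rewrite !mxE; under eq_fun do rewrite mxE.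
rewrite -big_split /=; apply: is_derive_sum_fun => k.
exact: is_deriveM_fun.
Qed.

(** Cramer's rule gives existence of the derivative; its value then follows by differentiating
    [invmx F * F = 1] and using uniqueness. *)
Lemma is_mxderive_inv n (E : set (R * R)) (F : R * R -> 'M[R]_n) G :
  open E -> E p -> (forall z, E z -> F z \in unitmx) ->
  entrywise (fun f => forall z, E z -> derivable f z v) F ->
  is_mxderive v F p G ->
  is_mxderive v (fun z => invmx (F z)) p (- (invmx (F p) *m G *m invmx (F p))).
Proof.
move=> oE Ep uF dF FG.
have dI := entrywise_inv (derivable_closed v oE) uF dF.
pose I' := \matrix_(i, j) 'D_v (fun z => invmx (F z) i j) p.
have II' : is_mxderive v (fun z => invmx (F z)) p I'.
  by move=> i j; rewrite mxE; apply: derivableP; exact: dI.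
apply: (is_mxderive_eq II').
have H1 := is_mxderiveM II' FG.
have H2 : is_mxderive v (fun z => invmx (F z) *m F z) p 0.
  apply: (is_mxderive_near _ (is_mxderive_cst 1%:M)).
  have := open_nbhs_nbhs (conj oE Ep); apply: filterS => z Ez.
  by rewrite mulVmx// uF.
have /eqP := is_mxderive_unique H1 H2.
rewrite addr_eq0 => /eqP /(congr1 (mulmx^~ (invmx (F p)))).
by rewrite /= mulmxK ?uF// mulNmx.
Qed.

Lemma is_mxderiveMl m n l (M : 'M[R]_(m, n)) (F : R * R -> 'M[R]_(n, l)) G :
  is_mxderive v F p G -> is_mxderive v (fun z => M *m F z) p (M *m G).
Proof.
move=> FG; apply: (is_mxderive_eq (is_mxderiveM (is_mxderive_cst M) FG)).
by rewrite mul0mx add0r.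
Qed.

Lemma is_mxderiveMr m n l (M : 'M[R]_(n, l)) (F : R * R -> 'M[R]_(m, n)) G :
  is_mxderive v F p G -> is_mxderive v (fun z => F z *m M) p (G *m M).
Proof.
move=> FG; apply: (is_mxderive_eq (is_mxderiveM FG (is_mxderive_cst M))).
by rewrite mulmx0 addr0.
Qed.

End MatrixDerivative.

(* The xi- and eta-equations for A, Pi and S are the cases s = -1 and s = 1 of
   one system, with Q in the role of q in the second case. *)
Definition darboux_flow (R : realType) (n : nat) (s : R) (v : R * R)
  (alpha : R * R -> R) (K : 'M[R]_2) (A S : R * R -> 'M[R]_n)
  (P : R * R -> 'M[R]_(n, 2)) (q : R * R -> 'M[R]_2) (p : R * R) : Prop :=
  let a := 'D_v alpha p / alpha p in
  let B := invmx (A p + s%:M) in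
  [/\ is_mxderive v A p (- a *: A p + (2 * a * s) *: 1%:M - (2 * a) *: B),
      is_mxderive v P p (B *m P p *m q p) &
      is_mxderive v S p (a *: (S p - 2 *: (B *m S p *m B^T))
        - B *m P p *m q p *m K *m (P p)^T *m B^T)].

Section DarbouxFlow.
Variables (R : realType) (n : nat) (s : R) (v : R * R).
Variables (alpha : R * R -> R) (K : 'M[R]_2) (A S : R * R -> 'M[R]_n).
Variables (P : R * R -> 'M[R]_(n, 2)) (q : R * R -> 'M[R]_2) (p : R * R).
Hypothesis flow : darboux_flow s v alpha K A S P q p.
Hypothesis ss : s * s = 1.
Hypothesis As_unit : A p + s%:M \in unitmx.
Hypothesis qK : q p *m K = - (K *m (q p)^T).

Let a := 'D_v alpha p / alpha p.
Let B z := invmx (A z + s%:M).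

Lemma sylvester_deriv : is_mxderive v
  (fun z => A z *m S z - S z *m (A z)^T - P z *m K *m (P z)^T) p 0.
Proof.
case: flow; rewrite -/a -/(B p) => dA dP dS.
have AB : A p *m B p = 1%:M - s *: B p.
  have : (A p + s%:M) *m B p = 1%:M by rewrite mulmxV.
  by rewrite mulmxDl mul_scalar_mx => <-; rewrite addrK.
have dAS := is_mxderiveM dA dS.
have dSA := is_mxderiveM dS (is_mxderive_tr dA).
have dPK := is_mxderiveM (is_mxderiveMr K dP) (is_mxderive_tr dP).
apply: (is_mxderive_eq (is_mxderiveB (is_mxderiveB dAS dSA) dPK)).
exact: sylvester_algebra.
Qed.

Variable E : set (R * R).
Hypotheses (oE : open E) (Ep : E p).
Hypothesis A_unit : forall z, E z -> A z \in unitmx.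
Hypothesis S_unit : forall z, E z -> S z \in unitmx.
Hypothesis dA : entrywise (fun f => forall z, E z -> derivable f z v) A.
Hypothesis dS : entrywise (fun f => forall z, E z -> derivable f z v) S.
Hypothesis ASA : A p *m S p - S p *m (A p)^T = P p *m K *m (P p)^T.

Let G z := K *m (P z)^T *m invmx (S z).

Let Q := darboux_potential a (B p) (P p) (G p)
  (K *m (P p)^T *m (B p)^T *m invmx (S p)) (q p).

Let dG : is_mxderive v G p (K *m (B p *m P p *m q p)^T *m invmx (S p) +
  K *m (P p)^T *m - (invmx (S p) *m (a *: (S p - 2 *: (B p *m S p *m (B p)^T))
        - B p *m P p *m q p *m K *m (P p)^T *m (B p)^T) *m invmx (S p))).
Proof.
case: flow; rewrite -/a -/(B p) => dA' dP' dS'.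
apply: is_mxderiveM; first by apply: is_mxderiveMl; exact: is_mxderive_tr.
exact: (is_mxderive_inv oE Ep S_unit dS dS').
Qed.

Lemma darboux_flow_product : is_mxderive v (fun z => G z *m P z) p
  (q p - Q - a *: (G p *m P p)).
Proof.
case: (flow); rewrite -/a -/(B p) => dA' dP' dS'.
apply: (is_mxderive_eq (is_mxderiveM dG dP')).
apply: (@darboux_deriv_product _ _ _ s a (A p)) => //.
- by rewrite mulVmx.
- by rewrite mulmxV// S_unit.
Qed.

Lemma darboux_flow_deriv :
  let U z := 1%:M - G z *m invmx (A z) *m P z in
  is_mxderive v U p (s *: (U p *m q p - Q *m U p)).
Proof.
move=> U; case: (flow); rewrite -/a -/(B p) => dA' dP' dS'.
have dC := is_mxderive_inv oE Ep A_unit dA dA'.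
have := is_mxderiveB (is_mxderive_cst v p 1%:M) (is_mxderiveM (is_mxderiveM dG dC) dP').
move=> H; apply: (is_mxderive_eq H).
rewrite sub0r mulmxDl.
apply: (@darboux_deriv _ _ _ s a (A p) (B p) _ (S p)) => //.
- by rewrite mulVmx.
- by rewrite mulVmx// A_unit.
- by rewrite mulmxV// S_unit.
Qed.

End DarbouxFlow.

(** * Joint continuity of solutions *)

(** A submultiplicative norm that makes sense over any numeric domain: it is used over [R] and, with
    values in [R[i]], for complex matrices. *)
Definition mx_norm1 (K : numDomainType) (m n : nat) (M : 'M[K]_(m, n)) : K :=
  \sum_i \sum_j `|M i j|.

Section MatrixNorm.
Variable K : numDomainType.

Lemma mx_norm1_ge0 m n (M : 'M[K]_(m, n)) : 0 <= mx_norm1 M.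
Proof. by apply: sumr_ge0 => i _; apply: sumr_ge0. Qed.

Lemma le_mx_norm1 m n (M : 'M[K]_(m, n)) i j : `|M i j| <= mx_norm1 M.
Proof.
rewrite /mx_norm1 (bigD1 i)//= (bigD1 j)//= -addrA lerDl addr_ge0//.
  exact: sumr_ge0.
by apply: sumr_ge0 => k _; exact: sumr_ge0.
Qed.

Lemma mx_norm1D m n (M N : 'M[K]_(m, n)) :
  mx_norm1 (M + N) <= mx_norm1 M + mx_norm1 N.
Proof.
rewrite -big_split; apply: ler_sum => i _; rewrite -big_split; apply: ler_sum => j _.
by rewrite mxE ler_normD.
Qed.

Lemma mx_norm1Z m n k (M : 'M[K]_(m, n)) : mx_norm1 (k *: M) = `|k| * mx_norm1 M.
Proof.
rewrite mulr_sumr; apply: eq_bigr => i _; rewrite mulr_sumr.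
by apply: eq_bigr => j _; rewrite mxE normrM.
Qed.

Lemma mx_norm1N m n (M : 'M[K]_(m, n)) : mx_norm1 (- M) = mx_norm1 M.
Proof. by rewrite -scaleN1r mx_norm1Z normrN1 mul1r. Qed.

Lemma mx_norm1M m n p (M : 'M[K]_(m, n)) (N : 'M[K]_(n, p)) :
  mx_norm1 (M *m N) <= mx_norm1 M * mx_norm1 N.
Proof.
rewrite mulr_suml; apply: ler_sum => i _.
apply: (@le_trans _ _ (\sum_j \sum_k `|M i k| * `|N k j|)).
  apply: ler_sum => j _; rewrite mxE; apply: le_trans (ler_norm_sum _ _ _) _.
  by apply: ler_sum => k _; rewrite normrM.
rewrite exchange_big mulr_suml; apply: ler_sum => k _ /=.
rewrite -mulr_sumr ler_wpM2l//.
by rewrite [leRHS](bigD1 k)//= lerDl; apply: sumr_ge0 => l _; exact: sumr_ge0.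
Qed.

End MatrixNorm.

Lemma fclosed_norm1 (K : numFieldType) (T : Type) (U : set T)
  (P : (T -> K) -> Prop) m n (F : T -> 'M[K]_(m, n)) : field_closed U P ->
  (forall f, P f -> P (fun t => `|f t|)) -> entrywise P F ->
  P (fun t => mx_norm1 (F t)).
Proof.
move=> cl Pn PF; rewrite /mx_norm1.
by apply: (fclosed_sum cl) => i; apply: (fclosed_sum cl) => j; exact: Pn.
Qed.

Lemma continuous_on_norm1 (K : numFieldType) (T : topologicalType) (U : set T)
  m n (F : T -> 'M[K]_(m, n)) : open U -> entrywise (@continuous_on K T U) F ->
  continuous_on U (fun t => mx_norm1 (F t)).
Proof.
move=> oU; apply: fclosed_norm1; first exact: continuous_on_closed.
by move=> f cf t Ut; apply: cvg_norm; exact: cf.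
Qed.

Lemma near_box (R : realType) (p : R * R) (Q : R * R -> Prop) :
  (\forall z \near p, Q z) -> exists2 r : R, 0 < r &
    forall q, `|p.1 - q.1| < r -> `|p.2 - q.2| < r -> Q q.
Proof.
move=> /nbhs_ballP [r /= r0 rD]; exists r => // q q1 q2.
by apply: rD; split; rewrite -ball_normE.
Qed.

Lemma trap_mx_continuous (R : realType) m n (F dF : R * R -> 'M[R]_(m, n))
  (p0 : R * R) (r M : R) : 0 < r ->
  (\forall p \near p0, is_mxderive (xi_dir R) F p (dF p) /\
     (mx_norm1 (F p - F p0) < r -> mx_norm1 (dF p) <= M)) ->
  (forall i j, derivable (fun z => F z i j) p0 (eta_dir R)) ->
  forall i j, {for p0, continuous (fun z => F z i j)}.
Proof.
move=> r0 /near_box [r1 r1_gt0 H] dFe i j.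
(* Entrywise distances below [r / N] add up to less than [r]; the added 1 keeps [N] positive for
   empty matrices and the inequality strict. *)
pose N : R := (m * n)%:R + 1.
have N0 : 0 < N by rewrite ltr_wpDl.
have rN0 : 0 < r / N by rewrite divr_gt0.
apply: (@trap_continuous _ ('I_m * 'I_n)%type (fun ij z => F z ij.1 ij.2) p0
  (Num.min r1 (r / N)) M _ _ _ (i, j)).
- by rewrite lt_min r1_gt0.
- move=> p; rewrite !lt_min => /andP[p1 _] /andP[p2 _].
  have [dFp Fb] := H p p1 p2; split=> [[k l]|near_p [k l]] /=.
    by have [] := dFp k l.
  have [_ ->] := dFp k l.
  apply: le_trans (le_mx_norm1 (dF p) k l) _; apply: Fb.
  apply: (@le_lt_trans _ _ (\sum_(i0 < m) \sum_(j0 < n) r / N)).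
    apply: ler_sum => i0 _; apply: ler_sum => j0 _; rewrite !mxE ltW//.
    by have := near_p (i0, j0); rewrite lt_min => /andP[].
  rewrite !sumr_const !card_ord -mulrnA mulnC -mulr_natl mulrA ltr_pdivrMr//.
  by rewrite mulrC ltr_pM2l// ltrDl.
- by move=> [k l]; exact: dFe.
Qed.

Lemma continuous_le_near (R : realType) (T : topologicalType) (f : T -> R) (t : T) :
  {for t, continuous f} -> \forall z \near t, `|f z| <= `|f t| + 1.
Proof.
move=> cf; have /cvgrPdist_lt /(_ 1 ltr01) : f z @[z --> t] --> f t by [].
apply: filterS => z zt; rewrite -lerBlDl; apply: le_trans (ltW zt).
by rewrite distrC lerB_dist.
Qed.

(** An affine growth bound gives a bound on the xi-derivative while [F] stays within distance 1 of
    its value at [p0], as trapping requires. *)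
Lemma affine_mx_continuous (R : realType) (D : set (R * R)) m n
  (F dF : R * R -> 'M[R]_(m, n)) (c0 c1 : R * R -> R) :
  open D -> continuous_on D c0 -> continuous_on D c1 ->
  (forall p, D p -> is_mxderive (xi_dir R) F p (dF p) /\
     mx_norm1 (dF p) <= c0 p + c1 p * mx_norm1 (F p)) ->
  (forall p, D p -> forall i j, derivable (fun z => F z i j) p (eta_dir R)) ->
  entrywise (continuous_on D) F.
Proof.
move=> oD cc0 cc1 H dFe i j p0 Dp0.
apply: (@trap_mx_continuous _ _ _ F dF p0 1
  (`|c0 p0| + 1 + (`|c1 p0| + 1) * (1 + mx_norm1 (F p0)))) => //; last exact: dFe.
have Dn := open_nbhs_nbhs (conj oD Dp0).
have n0 := continuous_le_near (cc0 p0 Dp0).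
have n1 := continuous_le_near (cc1 p0 Dp0).
near=> p.
have Dp : D p by near: p; exact: Dn.
have [dFp bF] := H p Dp; split=> // Fp; apply: le_trans bF _.
have h0 : `|c0 p| <= `|c0 p0| + 1 by near: p; exact: n0.
have h1 : `|c1 p| <= `|c1 p0| + 1 by near: p; exact: n1.
apply: lerD; first exact: le_trans (ler_norm _) h0.
apply: (@le_trans _ _ (`|c1 p| * mx_norm1 (F p))).
  by rewrite ler_wpM2r ?mx_norm1_ge0// ler_norm.
apply: ler_pM => //; first exact: mx_norm1_ge0.
rewrite -[F p](subrK (F p0)); apply: le_trans (mx_norm1D _ _) _.
by rewrite lerD2r ltW.
Unshelve. all: by end_near. Qed.

(* Writing Y^-1 = Y0^-1 - Y^-1 (Y - Y0) Y0^-1 bounds the inverse near Y0. *)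
Lemma mx_norm1_inv_le (R : numFieldType) n (Y Y0 : 'M[R]_n) :
  Y \in unitmx -> Y0 \in unitmx ->
  mx_norm1 (Y - Y0) * mx_norm1 (invmx Y0) <= 2^-1 ->
  mx_norm1 (invmx Y) <= 2 * mx_norm1 (invmx Y0).
Proof.
move=> uY uY0 h.
have E : invmx Y = invmx Y0 - invmx Y *m ((Y - Y0) *m invmx Y0).
  by rewrite mulmxBl mulmxBr mulmxA mulVmx// mulmxV// mul1mx mulmx1 subKr.
have h1 : mx_norm1 (invmx Y) <= mx_norm1 (invmx Y0) + mx_norm1 (invmx Y) * 2^-1.
  rewrite {1}E; apply: le_trans (mx_norm1D _ _) _; rewrite lerD2l mx_norm1N.
  apply: le_trans (mx_norm1M _ _) _; rewrite ler_wpM2l ?mx_norm1_ge0//.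
  exact: le_trans (mx_norm1M _ _) h.
move: h1; rewrite -lerBlDr -[X in X - _]mulr1 -mulrBr => h1.
have e2 : 1 - 2^-1 = 2^-1 :> R by field.
by move: h1; rewrite e2 ler_pdivrMr// mulrC.
Qed.

Lemma entrywise_partial_C1 (R : realType) (D : set (R * R)) (v : R * R) m n
  (F dF : R * R -> 'M[R]_(m, n)) : open D ->
  entrywise (continuous_on D) F -> entrywise (continuous_on D) dF ->
  (forall p, D p -> is_mxderive v F p (dF p)) -> entrywise (partial_C1 v D) F.
Proof.
move=> oD cF cdF FdF i j p Dp; split; first exact: cF.
  by have [] := FdF p Dp i j.
have E : 'D_v (fun z => F z i j) p = dF p i j by have [] := FdF p Dp i j.
change ('D_v (fun z => F z i j) x @[x --> p] --> 'D_v (fun z => F z i j) p).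
rewrite E; apply: cvg_trans (cdF i j p Dp); apply: near_eq_cvg.
have := open_nbhs_nbhs (conj oD Dp); apply: filterS => z Dz.
by have [] := FdF z Dz i j.
Qed.

Lemma entrywise_impl (K T : Type) (P P' : (T -> K) -> Prop) m n
  (F : T -> 'M[K]_(m, n)) :
  (forall f, P f -> P' f) -> entrywise P F -> entrywise P' F.
Proof. by move=> PP' PF i j; exact: PP'. Qed.

Lemma partial_C1_continuous (R : realType) (v : R * R) (U : set (R * R)) f :
  partial_C1 v U f -> continuous_on U f.
Proof. by move=> H p /H[]. Qed.

Lemma partial_C1_derivable (R : realType) (v : R * R) (U : set (R * R)) f :
  partial_C1 v U f -> forall p, U p -> derivable f p v.
Proof. by move=> H p /H[]. Qed.

Lemma partial_C1_subset (R : realType) (v : R * R) (U U' : set (R * R)) f :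
  U' `<=` U -> partial_C1 v U f -> partial_C1 v U' f.
Proof. by move=> UU' H p /UU' /H. Qed.

Section FlowRegularity.
Variables (R : realType) (n : nat) (D : set (R * R)) (oD : open D).
Variables (alpha : R * R -> R) (K : 'M[R]_2) (q Q : R * R -> 'M[R]_2).
Variables (A S : R * R -> 'M[R]_n) (P : R * R -> 'M[R]_(n, 2)).
Hypothesis alpha0 : forall p, D p -> alpha p != 0.
Hypothesis alpha_C1 : forall v, v = xi_dir R \/ v = eta_dir R -> partial_C1 v D alpha.
Hypotheses (cq : entrywise (continuous_on D) q) (cQ : entrywise (continuous_on D) Q).
Hypothesis flow_xi : forall p, D p -> darboux_flow (-1) (xi_dir R) alpha K A S P q p.
Hypothesis flow_eta : forall p, D p -> darboux_flow 1 (eta_dir R) alpha K A S P Q p.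
Hypothesis A_sub_unit : forall p, D p -> A p + (-1)%:M \in unitmx.
Hypothesis A_add_unit : forall p, D p -> A p + 1%:M \in unitmx.

Let cl := @continuous_on_closed R (R * R)%type D oD.

Lemma continuous_on_dlog v : v = xi_dir R \/ v = eta_dir R ->
  continuous_on D (fun p => 'D_v alpha p / alpha p).
Proof.
move=> /alpha_C1 av; apply: (fclosedM cl); first by move=> p /av[].
by apply: (fclosedV cl) => // p /av[].
Qed.

Let dlog_xi := continuous_on_dlog (or_introl erefl).

(** The equation for [A] has no affine bound, since the resolvent could blow up. The trapping radius
    is therefore adapted to the resolvent at [p0]. *)
Lemma flow_A_continuous : entrywise (continuous_on D) A.
Proof.
move=> i j p0 Dp0.
set B0 := invmx (A p0 + (-1)%:M); set a := fun p => 'D_(xi_dir R) alpha p / alpha p.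
(* Then [r] times the norm of [B0] is below one half, so within this radius the norm of the
   resolvent at most doubles. *)
pose r := (2 * (mx_norm1 B0 + 1))^-1.
have b0 := mx_norm1_ge0 B0.
have r0 : 0 < r by rewrite invr_gt0 mulr_gt0// ltr_wpDl.
pose c := `|a p0| + 1.
apply: (@trap_mx_continuous _ _ _ A (fun p => - a p *: A p + (2 * a p * (-1)) *: 1%:M
    - (2 * a p) *: invmx (A p + (-1)%:M)) p0 r
  (c * (r + mx_norm1 (A p0)) + 2 * c * mx_norm1 (1%:M : 'M[R]_n)
    + 2 * c * (2 * mx_norm1 B0))) => //; last first.
  by move=> k l; have [/(_ k l)[]] := flow_eta Dp0.
have Dn := open_nbhs_nbhs (conj oD Dp0).
have an := continuous_le_near (dlog_xi Dp0).
near=> p.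
have Dp : D p by near: p; exact: Dn.
have ap : `|a p| <= c by near: p; exact: an.
have [dA _ _] := flow_xi Dp; split=> // Ar.
have A_le : mx_norm1 (A p) <= r + mx_norm1 (A p0).
  rewrite -[A p](subrK (A p0)); apply: le_trans (mx_norm1D _ _) _.
  by rewrite lerD2r ltW.
have B_le : mx_norm1 (invmx (A p + (-1)%:M)) <= 2 * mx_norm1 B0.
  apply: mx_norm1_inv_le; rewrite ?A_sub_unit//.
  rewrite opprD addrACA subrr addr0 -/B0.
  apply: (@le_trans _ _ (r * (mx_norm1 B0 + 1))).
    by apply: ler_pM; rewrite ?mx_norm1_ge0// ?ltW// ltrDl.
  by rewrite /r invfM -mulrA mulVf ?mulr1// gt_eqF// ltr_wpDl.
have n2 : `|2 * a p| <= 2 * c by rewrite normrM gtr0_norm// ler_pM2l.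
apply: le_trans (mx_norm1D _ _) _; rewrite mx_norm1N mx_norm1Z.
apply: lerD; last by apply: ler_pM; rewrite ?mx_norm1_ge0.
apply: le_trans (mx_norm1D _ _) _; rewrite !mx_norm1Z mulrN1 !normrN.
by apply: lerD; apply: ler_pM; rewrite ?mx_norm1_ge0.
Unshelve. all: by end_near. Qed.

Let cA := flow_A_continuous.

Lemma flow_resolvent_continuous s : (forall p, D p -> A p + s%:M \in unitmx) ->
  entrywise (continuous_on D) (fun p => invmx (A p + s%:M)).
Proof.
move=> uA; apply: (entrywise_inv cl) => //.
by apply: (entrywiseD cl) => //; exact: (entrywise_cst cl).
Qed.

Let cB := flow_resolvent_continuous A_sub_unit.

(** Once the resolvent of [A] is continuous, the equation is linear in [P] with continuous
    coefficients. *)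
Lemma flow_P_continuous : entrywise (continuous_on D) P.
Proof.
apply: (@affine_mx_continuous _ D _ _ P (fun p => invmx (A p + (-1)%:M) *m P p *m q p)
  (fun=> 0) (fun p => mx_norm1 (invmx (A p + (-1)%:M)) * mx_norm1 (q p))) => //.
- exact: (fclosed_cst cl).
- by apply: (fclosedM cl); exact: continuous_on_norm1.
- move=> p Dp; have [_ dP _] := flow_xi Dp; split=> //.
  rewrite add0r mulrAC; apply: le_trans (mx_norm1M _ _) _.
  by rewrite ler_wpM2r ?mx_norm1_ge0// mx_norm1M.
- by move=> p Dp i j; have [_ /(_ i j)[]] := flow_eta Dp.
Qed.

Let cP := flow_P_continuous.
Let cK : entrywise (continuous_on D) (fun=> K).
Proof. exact: (entrywise_cst cl). Qed.

Lemma flow_source_continuous s q' : (forall p, D p -> A p + s%:M \in unitmx) ->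
  entrywise (continuous_on D) q' ->
  entrywise (continuous_on D) (fun p => invmx (A p + s%:M) *m P p *m q' p *m K
    *m (P p)^T *m (invmx (A p + s%:M))^T).
Proof.
move=> uA cq'; have cBs := flow_resolvent_continuous uA.
by repeat (apply: (entrywiseM cl) => // || apply: (entrywise_tr cl) => //).
Qed.

(** The equation is affine in [S]; its source involves only [A], [P] and [q], already continuous. *)
Lemma flow_S_continuous : entrywise (continuous_on D) S.
Proof.
pose B p := invmx (A p + (-1)%:M).
pose a p := 'D_(xi_dir R) alpha p / alpha p.
apply: (@affine_mx_continuous _ D _ _ S
  (fun p => a p *: (S p - 2 *: (B p *m S p *m (B p)^T))
    - B p *m P p *m q p *m K *m (P p)^T *m (B p)^T)
  (fun p => mx_norm1 (B p *m P p *m q p *m K *m (P p)^T *m (B p)^T))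
  (fun p => `|a p| * (1 + 2 * (mx_norm1 (B p) * mx_norm1 (B p)^T)))) => //.
- by apply: continuous_on_norm1 => //; exact: flow_source_continuous.
- apply: (fclosedM cl); first by move=> p Dp; apply: cvg_norm; exact: dlog_xi.
  apply: (fclosedD cl); first exact: (fclosed_cst cl).
  apply: (fclosedM cl); first exact: (fclosed_cst cl).
  apply: (fclosedM cl); apply: continuous_on_norm1 => //.
  exact: (entrywise_tr cl).
- move=> p Dp; have [_ _ dS] := flow_xi Dp; split=> //.
  rewrite [leRHS]addrC; apply: le_trans (mx_norm1D _ _) _; rewrite mx_norm1N lerD2r.
  rewrite mx_norm1Z -mulrA ler_wpM2l// mulrDl mul1r.
  apply: le_trans (mx_norm1D _ _) _; rewrite lerD2l mx_norm1N mx_norm1Z.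
  rewrite gtr0_norm// -mulrA ler_pM2l// mulrAC.
  apply: le_trans (mx_norm1M _ _) _.
  by rewrite ler_wpM2r ?mx_norm1_ge0// mx_norm1M.
- by move=> p Dp i j; have [_ _ /(_ i j)[]] := flow_eta Dp.
Qed.

Let cS := flow_S_continuous.

(** With [A], [P] and [S] jointly continuous, the right-hand sides of their equations are too, and
    these are the derivatives. *)
Lemma flow_partial_C1 s v q' : v = xi_dir R \/ v = eta_dir R ->
  (forall p, D p -> A p + s%:M \in unitmx) -> entrywise (continuous_on D) q' ->
  (forall p, D p -> darboux_flow s v alpha K A S P q' p) ->
  [/\ entrywise (partial_C1 v D) A, entrywise (partial_C1 v D) P &
      entrywise (partial_C1 v D) S].
Proof.
move=> v12 uA cq' flow; have ca := continuous_on_dlog v12.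
have cBs := flow_resolvent_continuous uA.
split.
- apply: (@entrywise_partial_C1 _ _ _ _ _ _ (fun p => - ('D_v alpha p / alpha p) *: A p
    + (2 * ('D_v alpha p / alpha p) * s) *: 1%:M
    - (2 * ('D_v alpha p / alpha p)) *: invmx (A p + s%:M))) => // [|p /flow[]//].
  have c2 : continuous_on D (fun p => 2 * ('D_v alpha p / alpha p)).
    by apply: (fclosedM cl) => //; exact: (fclosed_cst cl).
  apply: (entrywiseB cl); last exact: (entrywiseZ cl).
  apply: (entrywiseD cl); apply: (entrywiseZ cl) => //.
  + exact: (fclosedN cl ca).
  + by apply: (fclosedM cl) => //; exact: (fclosed_cst cl).
  + exact: (entrywise_cst cl).
- apply: (@entrywise_partial_C1 _ _ _ _ _ _
    (fun p => invmx (A p + s%:M) *m P p *m q' p)) => // [|p /flow[]//].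
  by repeat (apply: (entrywiseM cl) => //).
- apply: (@entrywise_partial_C1 _ _ _ _ _ _ (fun p => ('D_v alpha p / alpha p) *:
    (S p - 2 *: (invmx (A p + s%:M) *m S p *m (invmx (A p + s%:M))^T))
    - invmx (A p + s%:M) *m P p *m q' p *m K *m (P p)^T *m (invmx (A p + s%:M))^T))
    => // [|p /flow[]//].
  apply: (entrywiseB cl); last exact: flow_source_continuous.
  apply: (entrywiseZ cl) => //; apply: (entrywiseB cl) => //.
  apply: (entrywiseZ cl); first exact: (fclosed_cst cl).
  by repeat (apply: (entrywiseM cl) => // || apply: (entrywise_tr cl) => //).
Qed.

End FlowRegularity.

(** * The transformed field equation over the reals *)

(** Both sides are the determinant of the block matrix with identity diagonal blocks and
    off-diagonal blocks [M] and [N]. *)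
Lemma det_1_sub_mulmxC (F : comNzRingType) m n (M : 'M[F]_(m, n)) (N : 'M[F]_(n, m)) :
  \det (1%:M - M *m N) = \det (1%:M - N *m M).
Proof.
have h1 : block_mx 1%:M M N 1%:M *m block_mx 1%:M 0 (- N) 1%:M =
    block_mx (1%:M - M *m N) M 0 1%:M.
  by rewrite mulmx_block !(mulmx1, mul1mx, mulmx0, add0r, mulmxN, subrr).
have h2 : block_mx 1%:M 0 (- N) 1%:M *m block_mx 1%:M M N 1%:M =
    block_mx 1%:M M 0 (1%:M - N *m M).
  rewrite mulmx_block !(mulmx1, mul1mx, mul0mx, addr0, mulNmx).
  by rewrite addrC subrr addrC.
have := congr1 determinant h1; rewrite det_mulmx det_lblock det_ublock !det1 !mulr1.
have := congr1 determinant h2; rewrite det_mulmx det_lblock det_ublock !det1 !mul1r.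
by move=> -> ->.
Qed.

Section DarbouxDet.
Variables (F : fieldType) (n m : nat) (A S : 'M[F]_n) (P : 'M[F]_(n, m)) (K : 'M[F]_m).

(** Exchanging the factors moves the determinant to size [n], where [P K P^T] appears and can be
    replaced by [A S - S A^T]. *)
Lemma det_darboux : A \in unitmx -> S \in unitmx ->
  A *m S - S *m A^T = P *m K *m P^T ->
  \det (1%:M - K *m P^T *m invmx S *m invmx A *m P) = 1.
Proof.
move=> uA uS ASA.
rewrite -[K *m _ *m _ *m _ *m P]mulmxA det_1_sub_mulmxC.
have -> : 1%:M - invmx A *m P *m (K *m P^T *m invmx S) =
    invmx A *m S *m A^T *m invmx S.
  have -> : invmx A *m P *m (K *m P^T *m invmx S) =
      invmx A *m (P *m K *m P^T) *m invmx S by rewrite !mulmxA.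
  rewrite -ASA mulmxBr mulmxBl !mulmxA mulVmx// mul1mx mulmxV//.
  by rewrite opprB addrC subrK.
rewrite !det_mulmx det_tr !det_inv; move: uA uS; rewrite !unitmxE !unitfE => dA dS.
by field; apply/andP; split.
Qed.

End DarbouxDet.

(** Continuity of the two partial derivatives is given, that of [F] is not; it comes from the affine
    bound with zero slope. *)
Lemma C1_partial (R : realType) (D : set (R * R)) m n (F : R * R -> 'M[R]_(m, n)) :
  open D ->
  (forall v p, v = xi_dir R \/ v = eta_dir R -> D p -> forall i j,
     derivable (fun z => F z i j) p v /\
     {for p, continuous ('D_v (fun z => F z i j))}) ->
  forall v, v = xi_dir R \/ v = eta_dir R -> entrywise (partial_C1 v D) F.
Proof.
move=> oD H v v12.
pose dF w p := \matrix_(i, j) 'D_w (fun z => F z i j) p.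
have FdF w p : w = xi_dir R \/ w = eta_dir R -> D p -> is_mxderive w F p (dF w p).
  move=> w12 Dp i j; rewrite mxE; apply: derivableP.
  by have [] := H w p w12 Dp i j.
have cdF w : w = xi_dir R \/ w = eta_dir R -> entrywise (continuous_on D) (dF w).
  move=> w12 i j p Dp.
  have -> : (fun t => dF w t i j) = 'D_w (fun z => F z i j).
    by apply/funext => t; rewrite mxE.
  by have [] := H w p w12 Dp i j.
apply: (@entrywise_partial_C1 _ _ _ _ _ _ (dF v)) => //; last first.
- by move=> p; exact: FdF.
- exact: cdF.
have cl := @continuous_on_closed R (R * R)%type D oD.
apply: (@affine_mx_continuous _ D _ _ F (dF (xi_dir R))
  (fun p => mx_norm1 (dF (xi_dir R) p)) (fun=> 0)) => //.
- by apply: continuous_on_norm1 => //; apply: cdF; left.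
- exact: (fclosed_cst cl).
- by move=> p Dp; split; [apply: FdF => //; left|rewrite mul0r addr0].
- by move=> p Dp i j; have [] := H (eta_dir R) p (or_intror erefl) Dp i j.
Qed.

Lemma entrywise_potential (F : fieldType) (T : Type) (U : set T)
  (C : (T -> F) -> Prop) n m (alpha a : T -> F) (K : 'M[F]_m) (s : F)
  (A S : T -> 'M[F]_n) (P : T -> 'M[F]_(n, m)) (q : T -> 'M[F]_m) :
  field_closed U C -> C alpha -> C a ->
  entrywise C A -> entrywise C S -> entrywise C P -> entrywise C q ->
  (forall t, U t -> A t + s%:M \in unitmx) -> (forall t, U t -> S t \in unitmx) ->
  entrywise C (fun t => alpha t *: (q t -
    darboux_potential (a t) (invmx (A t + s%:M)) (P t) (K *m (P t)^T *m invmx (S t))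
      (K *m (P t)^T *m (invmx (A t + s%:M))^T *m invmx (S t)) (q t))).
Proof.
move=> cl Ca Cdl eA eS eP eq uA uS.
have eK : entrywise C (fun=> K) by exact: (entrywise_cst cl).
have e1 : entrywise C (fun=> 1%:M : 'M[F]_m) by exact: (entrywise_cst cl).
have eB : entrywise C (fun t => invmx (A t + s%:M)).
  apply: (entrywise_inv cl) => //.
  by apply: (entrywiseD cl) => //; exact: (entrywise_cst cl).
have eX : entrywise C (fun t => invmx (S t)) by exact: (entrywise_inv cl).
have ePt := entrywise_tr cl eP.
have eBt := entrywise_tr cl eB.
have eKP := entrywiseM cl eK ePt.
have eG := entrywiseM cl eKP eX.
have eHP := entrywiseD cl e1 (entrywiseM cl (entrywiseM cl (entrywiseM cl eKP eBt) eX) eP).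
have eGB := entrywiseM cl eG eB.
have C2 : C (fun t => 2 * a t) by apply: (fclosedM cl) => //; exact: (fclosed_cst cl).
apply: (entrywiseZ cl) => //; apply: (entrywiseB cl) => //; apply: (entrywiseB cl).
  exact: (entrywiseM cl (entrywiseM cl (entrywiseB cl e1 (entrywiseM cl eGB eP)) eq) eHP).
apply: (entrywiseZ cl C2).
exact: (entrywiseM cl (entrywiseM cl (entrywiseM cl eGB eB) eP) eHP).
Qed.

Definition flow_potential (R : realType) (n : nat) (s : R) (v : R * R)
  (alpha : R * R -> R) (K : 'M[R]_2) (A S : R * R -> 'M[R]_n)
  (P : R * R -> 'M[R]_(n, 2)) (q : R * R -> 'M[R]_2) (p : R * R) : 'M[R]_2 :=
  darboux_potential ('D_v alpha p / alpha p) (invmx (A p + s%:M)) (P p)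
    (K *m (P p)^T *m invmx (S p))
    (K *m (P p)^T *m (invmx (A p + s%:M))^T *m invmx (S p)) (q p).

(* alpha times the logarithmic derivative of the transformed solution *)
Definition dressed_current (R : realType) (n : nat) (s : R) (v : R * R)
  (alpha : R * R -> R) (K : 'M[R]_2) (A S : R * R -> 'M[R]_n)
  (P : R * R -> 'M[R]_(n, 2)) (q : R * R -> 'M[R]_2) (p : R * R) : 'M[R]_2 :=
  'D_v alpha p *: 1%:M - (s * alpha p) *: flow_potential s v alpha K A S P q p.

Section RealField.
Variables (R : realType) (n : nat) (D : set (R * R)) (oD : open D).
Variables (alpha : R * R -> R) (K : 'M[R]_2) (q Q : R * R -> 'M[R]_2).
Variables (A S : R * R -> 'M[R]_n) (P : R * R -> 'M[R]_(n, 2)).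
Hypothesis alpha0 : forall p, D p -> alpha p != 0.
Hypothesis alpha_C1 : forall v, v = xi_dir R \/ v = eta_dir R -> partial_C1 v D alpha.
Hypothesis alpha_xi_C1 : partial_C1 (eta_dir R) D ('D_(xi_dir R) alpha).
Hypothesis alpha_eta_C1 : partial_C1 (xi_dir R) D ('D_(eta_dir R) alpha).
Hypothesis alpha_mixed : forall p, D p ->
  'D_(eta_dir R) ('D_(xi_dir R) alpha) p = 0 /\
  'D_(xi_dir R) ('D_(eta_dir R) alpha) p = 0.
Hypothesis q_C1 : forall v, v = xi_dir R \/ v = eta_dir R ->
  entrywise (partial_C1 v D) q.
Hypothesis Q_C1 : forall v, v = xi_dir R \/ v = eta_dir R ->
  entrywise (partial_C1 v D) Q.
Hypothesis qK : forall p, D p -> q p *m K = - (K *m (q p)^T).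
Hypothesis QK : forall p, D p -> Q p *m K = - (K *m (Q p)^T).
Hypothesis flow_xi : forall p, D p -> darboux_flow (-1) (xi_dir R) alpha K A S P q p.
Hypothesis flow_eta : forall p, D p -> darboux_flow 1 (eta_dir R) alpha K A S P Q p.
Hypothesis A_sub_unit : forall p, D p -> A p + (-1)%:M \in unitmx.
Hypothesis A_add_unit : forall p, D p -> A p + 1%:M \in unitmx.
Hypothesis ASA : forall p, D p -> A p *m S p - S p *m (A p)^T = P p *m K *m (P p)^T.

Let cq : entrywise (continuous_on D) q.
Proof.
by apply: entrywise_impl (q_C1 (or_introl erefl)); exact: partial_C1_continuous.
Qed.

Let cQ : entrywise (continuous_on D) Q.
Proof.
by apply: entrywise_impl (Q_C1 (or_introl erefl)); exact: partial_C1_continuous.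
Qed.

Let regular v : v = xi_dir R \/ v = eta_dir R ->
  [/\ entrywise (partial_C1 v D) A, entrywise (partial_C1 v D) P &
      entrywise (partial_C1 v D) S].
Proof.
case=> ->.
  exact: (flow_partial_C1 oD alpha0 alpha_C1 cq flow_xi flow_eta
    A_sub_unit (or_introl erefl) A_sub_unit cq flow_xi).
exact: (flow_partial_C1 oD alpha0 alpha_C1 cq flow_xi flow_eta
    A_sub_unit (or_intror erefl) A_add_unit cQ flow_eta).
Qed.

Let E : set (R * R) := [set p | [/\ D p, S p \in unitmx & A p \in unitmx]].

Let ED : E `<=` D. Proof. by move=> p []. Qed.

Lemma open_darboux_domain : open E.
Proof.
have [cA _ cS] := regular (or_introl erefl).
have cl := @continuous_on_closed R (R * R)%type D oD.
have dnz (F : R * R -> 'M[R]_n) p : entrywise (partial_C1 (xi_dir R) D) F ->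
    D p -> F p \in unitmx -> \forall z \near p, F z \in unitmx.
  move=> F1 Dp uF.
  have cF : entrywise (continuous_on D) F.
    by apply: entrywise_impl F1; exact: partial_C1_continuous.
  have cd := fclosed_det cl cF; have := cd p Dp.
  move=> /cvgr_neq0 H; have := H _; rewrite -unitfE -unitmxE => /(_ uF).
  by apply: filterS => z; rewrite -unitfE -unitmxE.
rewrite openE => p [Dp uS uA]; near=> z; split; near: z.
- exact: open_nbhs_nbhs.
- exact: dnz.
- exact: dnz.
Unshelve. all: by end_near. Qed.

Let oE := open_darboux_domain.

Let G p := K *m (P p)^T *m invmx (S p).
Local Notation pot s v q' := (flow_potential s v alpha K A S P q').
Local Notation current s v q' := (dressed_current s v alpha K A S P q').
Let N p := alpha p *: (G p *m P p).

Let subE v m k (F : R * R -> 'M[R]_(m, k)) :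
  entrywise (partial_C1 v D) F -> entrywise (partial_C1 v E) F.
Proof. by apply: entrywise_impl => f; exact: partial_C1_subset. Qed.

Let derE v m k (F : R * R -> 'M[R]_(m, k)) : entrywise (partial_C1 v D) F ->
  entrywise (fun f => forall z, E z -> derivable f z v) F.
Proof. by move=> /subE; apply: entrywise_impl => f; exact: partial_C1_derivable. Qed.

Section OneDirection.
Variables (s : R) (v : R * R) (q' : R * R -> 'M[R]_2).
Hypothesis v12 : v = xi_dir R \/ v = eta_dir R.
Hypothesis ss : s * s = 1.
Hypothesis q'K : forall p, D p -> q' p *m K = - (K *m (q' p)^T).
Hypothesis flow : forall p, D p -> darboux_flow s v alpha K A S P q' p.
Hypothesis uA : forall p, D p -> A p + s%:M \in unitmx.

(** The derivative of the factor [alpha] compensates the term [- a G P] of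
    [darboux_deriv_product]. *)
Lemma darboux_product_deriv p : E p ->
  is_mxderive v N p (alpha p *: (q' p - pot s v q' p)).
Proof.
move=> Ep; have [Dp uS uAp] := Ep; have [rA rP rS] := regular v12.
have [_ da _] := alpha_C1 v12 Dp.
have uS' z : E z -> S z \in unitmx by case.
have H := darboux_flow_product (flow Dp) (uA Dp) (q'K Dp) oE Ep uS'
  (derE rS) (ASA Dp).
apply: (is_mxderive_eq (is_mxderiveZ (derivableP da) H)).
rewrite /flow_potential -/(G p).
move: (darboux_potential _ _ _ _ _ _) (G p *m P p) => Q1 GP.
by apply/matrixP => i j; rewrite !(mxDE, mxNE, mxZE); field; exact: alpha0.
Qed.

(** In the derivative of [U u] the terms [U q u] cancel, leaving [- s Q1 U u]; differentiating
    [alpha] adds the scalar part of the current. The constant [c] is to be [d^(-1/2)]. *)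
Lemma darboux_solution_deriv (u : R * R -> 'M[R]_2) (c : R) p : E p ->
  is_mxderive v u p (- s *: (q' p *m u p)) ->
  let V z := (1%:M - K *m (P z)^T *m invmx (S z) *m invmx (A z) *m P z) *m u z in
  is_mxderive v (fun z => (alpha z * c) *: V z) p
    (c *: (current s v q' p *m V p)).
Proof.
move=> Ep du V; have [Dp uS uAp] := Ep; have [rA rP rS] := regular v12.
have [_ da _] := alpha_C1 v12 Dp.
have uS' z : E z -> S z \in unitmx by case.
have uA' z : E z -> A z \in unitmx by case.
have H := darboux_flow_deriv (flow Dp) ss (uA Dp) (q'K Dp) oE Ep uA' uS'
  (derE rA) (derE rS) (ASA Dp).
have dV : is_mxderive v V p (- s *: (pot s v q' p *m V p)).
  apply: (is_mxderive_eq (is_mxderiveM H du)).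
  rewrite /V /flow_potential -/(G p).
  move: (darboux_potential _ _ _ _ _ _) => Q1.
  set U := 1%:M - G p *m invmx (A p) *m P p; move: U => U.
  by rewrite !mx_expand; mx_linear.
have dac : is_derive p v (fun z => alpha z * c) ('D_v alpha p * c).
  apply: (is_derive_eq (is_deriveM_fun (derivableP da) (is_derive_cst _ _ _))).
  by rewrite mulr0 addr0.
apply: (is_mxderive_eq (is_mxderiveZ dac dV)).
rewrite /dressed_current; move: (V p) (flow_potential _ _ _ _ _ _ _ _ _) => V' Q1.
by rewrite !mx_expand; mx_linear.
Qed.

(** Used with [w] different from [v]: it makes the mixed derivatives of [N] exist and be continuous,
    as [schwarz] needs. *)
Lemma darboux_pot_C1 w : w = xi_dir R \/ w = eta_dir R ->
  partial_C1 w D ('D_v alpha) -> entrywise (partial_C1 w D) q' ->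
  entrywise (partial_C1 w E) (fun p => alpha p *: (q' p - pot s v q' p)).
Proof.
move=> w12 dva q'C1; have [rA rP rS] := regular w12.
have cl := @partial_C1_closed R w E oE.
have ca : partial_C1 w E alpha by apply: partial_C1_subset (alpha_C1 w12).
have cdl : partial_C1 w E (fun p => 'D_v alpha p / alpha p).
  apply: (fclosedM cl); first exact: partial_C1_subset dva.
  by apply: (fclosedV cl); [exact: ca|move=> z /ED; exact: alpha0].
have uAE z : E z -> A z + s%:M \in unitmx by move=> /ED; exact: uA.
have uSE z : E z -> S z \in unitmx by case.
exact: (@entrywise_potential _ _ _ _ _ _ _ _ K s _ _ _ _ cl ca cdl
  (subE rA) (subE rS) (subE rP) (subE q'C1) uAE uSE).
Qed.

End OneDirection.

(** A common [X] for both derivatives expresses the field equation of [u], because [Q] carries a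
    minus sign. With [Z] the common mixed derivative of [N] and no contribution from [alpha_xi] and
    [alpha_eta], the two currents have derivatives [X - Z] and [- (X - Z)]. *)
Lemma darboux_field_equation p X : E p ->
  is_mxderive (eta_dir R) (fun z => alpha z *: q z) p X ->
  is_mxderive (xi_dir R) (fun z => alpha z *: Q z) p X ->
  exists2 Y, is_mxderive (eta_dir R) (current (-1) (xi_dir R) q) p Y &
    is_mxderive (xi_dir R) (current 1 (eta_dir R) Q) p (- Y).
Proof.
move=> Ep dq dQ.
have v1 : xi_dir R = xi_dir R \/ xi_dir R = eta_dir R by left.
have v2 : eta_dir R = xi_dir R \/ eta_dir R = eta_dir R by right.
pose fx p := alpha p *: (q p - pot (-1) (xi_dir R) q p).
pose fe p := alpha p *: (Q p - pot 1 (eta_dir R) Q p).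
have Nx z : E z -> is_mxderive (xi_dir R) N z (fx z).
  by apply: (darboux_product_deriv v1) => //; rewrite mulrNN mulr1.
have Ne z : E z -> is_mxderive (eta_dir R) N z (fe z).
  by apply: (darboux_product_deriv v2) => //; rewrite mulr1.
have fxC : entrywise (partial_C1 (eta_dir R) E) fx.
  exact: (darboux_pot_C1 A_sub_unit v2 alpha_xi_C1 (q_C1 v2)).
have feC : entrywise (partial_C1 (xi_dir R) E) fe.
  exact: (darboux_pot_C1 A_add_unit v1 alpha_eta_C1 (Q_C1 v1)).
pose Z := \matrix_(i, j) 'D_(eta_dir R) (fun z => fx z i j) p.
have dfx : is_mxderive (eta_dir R) fx p Z.
  by move=> i j; rewrite mxE; apply: derivableP; have [] := fxC i j p Ep.
have dfe : is_mxderive (xi_dir R) fe p Z.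
  move=> i j; rewrite mxE.
  have [_ dfe _] := feC i j p Ep.
  have -> : 'D_(eta_dir R) (fun z => fx z i j) p = 'D_(xi_dir R) (fun z => fe z i j) p.
    apply: (@schwarz R E (fun z => N z i j) _ _ p oE Ep); last exact: dfe.
    - by move=> z Ez; exact: Nx.
    - by move=> z Ez; exact: Ne.
    - by move=> z Ez; have [] := fxC i j z Ez.
    - by have [] := fxC i j p Ep.
  exact: derivableP.
have [Dp _ _] := Ep.
exists (X - Z).
  have [_ da _] := alpha_xi_C1 Dp; have [am _] := alpha_mixed Dp.
  have H := is_mxderiveD (is_mxderiveZ (derivableP da) (is_mxderive_cst _ _ (1%:M : 'M[R]_2)))
    (is_mxderiveB dq dfx).
  have WE : current (-1) (xi_dir R) q = fun z =>
      'D_(xi_dir R) alpha z *: 1%:M + (alpha z *: q z - fx z).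
    by apply/funext => z; rewrite /dressed_current /fx; mx_linear.
  by rewrite WE; apply: (is_mxderive_eq H); rewrite am scale0r scaler0 !add0r.
have [_ da _] := alpha_eta_C1 Dp; have [_ am] := alpha_mixed Dp.
have H := is_mxderiveB (is_mxderiveZ (derivableP da) (is_mxderive_cst _ _ (1%:M : 'M[R]_2)))
  (is_mxderiveB dQ dfe).
have WE : current 1 (eta_dir R) Q = fun z =>
    'D_(eta_dir R) alpha z *: 1%:M - (alpha z *: Q z - fe z).
  by apply/funext => z; rewrite /dressed_current /fe; mx_linear.
by rewrite WE; apply: (is_mxderive_eq H); rewrite am scale0r scaler0 !add0r.
Qed.

End RealField.

(** * Reality of the solutions *)

Local Open Scope complex_scope.
Local Open Scope sesquilinear_scope.

Lemma sqrt_sum_sqr_le (R : rcfType) (x y : R) :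
  Num.sqrt (x ^+ 2 + y ^+ 2) <= `|x| + `|y|.
Proof.
apply: (@le_trans _ _ (Num.sqrt ((`|x| + `|y|) ^+ 2))); last first.
  by rewrite sqrtr_sqr ger0_norm// addr_ge0.
rewrite ler_wsqrtr// sqrrD !real_normK ?num_real// addrAC lerDl.
by rewrite mulrn_wge0// mulr_ge0.
Qed.

Section ComplexContinuity.
Variables (R : realType) (T : topologicalType).
Implicit Types (f : T -> R[i]) (t : T).

Lemma continuous_Re f t :
  @continuous_at T (R[i] : numFieldType) t f ->
  {for t, continuous (fun s => complex.Re (f s))}.
Proof.
move=> cf; apply/cvgrPdist_lt => e e0.
have e0' : 0 < e%:C :> R[i] by rewrite ltcR.
move/cvgrPdist_lt : cf => /(_ _ e0'); apply: filterS => s.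
rewrite normc_def ltcR; apply: le_lt_trans; rewrite -raddfB.
by rewrite -sqrtr_sqr ler_wsqrtr// lerDl sqr_ge0.
Qed.

Lemma continuous_complex f t :
  {for t, continuous (fun s => complex.Re (f s))} ->
  {for t, continuous (fun s => complex.Im (f s))} ->
  @continuous_at T (R[i] : numFieldType) t f.
Proof.
move=> cRe cIm; apply/cvgrPdist_lt => e.
rewrite ltcE /= => /andP[/eqP Ime e0].
have e2 : 0 < complex.Re e / 2 by rewrite divr_gt0.
move/cvgrPdist_lt : cRe => /(_ _ e2) nRe.
move/cvgrPdist_lt : cIm => /(_ _ e2) nIm.
apply: (filterS2 _ _ nRe nIm) => s hRe hIm.
rewrite normc_def ltcE /= Ime eqxx /= !raddfB.
apply: le_lt_trans (sqrt_sum_sqr_le _ _) _.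
by rewrite [ltRHS]splitr ltrD.
Qed.

End ComplexContinuity.

Lemma continuous_along_closed (R : realType) (K : numFieldType) (v : R * R)
  (D : set (R * R)) : open D ->
  field_closed D (fun f : R * R -> K => forall p, D p -> continuous_along v f p).
Proof.
move=> oD; have E0 (p : R * R) : p + 0 *: v = p by rewrite scale0r addr0.
split=> [k|f g cf cg|f g cf cg|f cf f0|f g fg cf] p Dp.
- exact: cst_continuous.
- by apply: cvgD; [exact: cf|exact: cg].
- by apply: cvgM; [exact: cf|exact: cg].
- by apply: cvgV; [rewrite E0; exact: f0|exact: cf].
- have cl : {for (0 : R), continuous (fun t : R => p + t *: v)}.
    by apply: cvgD; [exact: cvg_cst|apply: cvgZl; exact: cvg_id].
  have nD : \forall t \near (0 : R), D (p + t *: v).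
    by apply: cl; rewrite E0; exact: open_nbhs_nbhs.
  change (g (p + t *: v) @[t --> (0 : R)] --> g (p + 0 *: v)).
  rewrite E0 -fg ?inE// -[p in f p]E0; apply: (cvg_trans _ (cf p Dp)).
  apply: near_eq_cvg.
  by near=> t; apply: fg; rewrite inE; near: t; exact: nD.
Unshelve. all: by end_near. Qed.

Lemma derivable_continuous_along (R : realType) (v : R * R) (f : R * R -> R) p :
  derivable f p v -> continuous_along v f p.
Proof.
move=> df; apply: differentiable_continuous; apply/derivable1_diffP.
have := @is_derive_line _ _ f p v 0 ('D_v f p).
by rewrite scale0r addr0 => /(_ (derivableP df)) [].
Qed.

Lemma pderivable_continuous_along (R : realType) (v : R * R) m n
  (F : R * R -> 'M[R[i]]_(m, n)) (D : set (R * R)) :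
  (forall p, D p -> pderivable v F p) ->
  entrywise (fun f : R * R -> R[i] => forall p, D p ->
    @continuous_along R (R[i] : numFieldType) v f p) F.
Proof.
move=> dF i j p Dp; have [dRe dIm] := dF p Dp i j.
apply: continuous_complex.
  exact: (derivable_continuous_along dRe).
exact: (derivable_continuous_along dIm).
Qed.

Notation conjmx := (map_mx conjc).

Section ConjMatrix.
Variable R : realType.
Implicit Types x y : R[i].

Lemma conjcM x y : (x * y)^*%C = x^*%C * y^*%C. Proof. exact: rmorphM. Qed.

Lemma conjcN x : (- x)^*%C = - x^*%C. Proof. exact: rmorphN. Qed.

Lemma conjmxD m n (M N : 'M[R[i]]_(m, n)) : conjmx (M + N) = conjmx M + conjmx N.
Proof. exact: map_mxD. Qed.

Lemma conjmxB m n (M N : 'M[R[i]]_(m, n)) : conjmx (M - N) = conjmx M - conjmx N.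
Proof. exact: map_mxB. Qed.

Lemma conjmxN m n (M : 'M[R[i]]_(m, n)) : conjmx (- M) = - conjmx M.
Proof. exact: map_mxN. Qed.

Lemma conjmxZ m n x (M : 'M[R[i]]_(m, n)) : conjmx (x *: M) = x^*%C *: conjmx M.
Proof. exact: map_mxZ. Qed.

Lemma conjmxM m n p (M : 'M[R[i]]_(m, n)) (N : 'M[R[i]]_(n, p)) :
  conjmx (M *m N) = conjmx M *m conjmx N.
Proof. exact: map_mxM. Qed.

Lemma conjmx1 n : conjmx (1%:M : 'M[R[i]]_n) = 1%:M.
Proof. exact: map_mx1. Qed.

Lemma conjmx_tr m n (M : 'M[R[i]]_(m, n)) : conjmx M^T = (conjmx M)^T.
Proof. by rewrite map_trmx. Qed.

Lemma conjmx_resolvent n (M : 'M[R[i]]_n) (s : R) :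
  conjmx (invmx (M + s%:C%:M)) = invmx (conjmx M + s%:C%:M).
Proof.
rewrite map_invmx map_mxD map_scalar_mx; congr (invmx (_ + _%:M)).
exact: conjc_real.
Qed.

End ConjMatrix.

Lemma realmx_conj (R : realType) m n (M : 'M[R[i]]_(m, n)) :
  M \is a realmx <-> conjmx M = M.
Proof.
split=> [/mxOverP H|H].
  by apply/matrixP => i j; rewrite mxE; have /complex_realP [k ->] := H i j;
    rewrite conjc_real.
apply/mxOverP => i j; have := congr1 (fun N : 'M[R[i]]_(m, n) => N i j) H; rewrite mxE.
case: (M i j) => a b [] /eqP; rewrite -subr_eq0 -opprD oppr_eq0 -mulr2n mulrn_eq0 /=.
by rewrite complex_real.
Qed.

Lemma mx_norm1_conj (R : realType) m n (M : 'M[R[i]]_(m, n)) :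
  mx_norm1 (conjmx M) = mx_norm1 M.
Proof.
apply: eq_bigr => i _; apply: eq_bigr => j _; rewrite mxE.
by case: (M i j) => a b; rewrite !normc_def /= sqrrN.
Qed.

(** Translates an estimate on [M - conj M] into one on imaginary parts, to which the real
    propagation lemma applies. *)
Lemma mx_norm1_sub_conj (R : realType) m n (M : 'M[R[i]]_(m, n)) :
  mx_norm1 (M - conjmx M) = (2 * \sum_i \sum_j `|complex.Im (M i j)|)%:C.
Proof.
rewrite rmorphM rmorph_sum mulr_sumr; apply: eq_bigr => i _.
rewrite rmorph_sum mulr_sumr; apply: eq_bigr => j _; rewrite !mxE.
case: (M i j) => a b; rewrite normc_def /= -rmorphM /=; congr (_%:C).
by rewrite subrr opprK expr0n add0r sqrtr_sqr -mulr2n normrMn mulr_natl.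
Qed.

(** The imaginary parts of the entries vanish at [p0] and satisfy a linear differential inequality
    along both axes. The coefficient [c] is complex valued because the norm is. *)
Lemma pde_realmx (R : realType) (D : set (R * R)) m n
  (F : R * R -> 'M[R[i]]_(m, n)) (p0 : R * R) :
  open D -> connected D -> D p0 -> F p0 \is a realmx ->
  (forall v, v = xi_dir R \/ v = eta_dir R -> exists c : R * R -> R[i],
    forall p, D p -> exists G : 'M[R[i]]_(m, n), [/\ is_pderive v F p G, 0 <= c p,
     mx_norm1 (G - conjmx G) <= c p * mx_norm1 (F p - conjmx (F p)) &
     @continuous_along R (R[i] : numFieldType) v c p]) ->
  forall p, D p -> F p \is a realmx.
Proof.
move=> oD cD Dp0 F0 H p Dp; apply/mxOverP => i j.
suff h : forall ij : 'I_m * 'I_n, im_entry F ij.1 ij.2 p = 0.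
  have := h (i, j); rewrite /im_entry /=; case: (F p i j) => a b /= ->.
  by rewrite complex_real.
apply: (@vanish_connected R _ D (fun ij : 'I_m * 'I_n => im_entry F ij.1 ij.2) p0) => //.
  move=> [k l]; rewrite /im_entry /=.
  by move/mxOverP : F0 => /(_ k l) /complex_realP [x ->].
move=> v v12; have [c Hc] := H v v12; exists (fun z => complex.Re (c z)) => z Dz.
have [G [[dFz dFE] c0 cb cc]] := Hc z Dz.
split; last exact: continuous_Re.
move=> [k l] /=; split; first by have [] := dFz k l.
have -> : 'D_v (im_entry F k l) z = complex.Im (G k l) by rewrite -dFE mxE.
move: cb; rewrite !mx_norm1_sub_conj -[c z]RRe_real ?ger0_real// -rmorphM lecR.
rewrite mulrCA ler_pM2l// => cb.
rewrite -(pair_big xpredT xpredT (fun k l => `|im_entry F k l z|)) /=.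
apply: le_trans cb; rewrite (bigD1 k)//= (bigD1 l)//= -addrA lerDl addr_ge0 ?sumr_ge0//.
by move=> x _; exact: sumr_ge0.
Qed.

Lemma continuous_along_normr (R : realType) (K : numFieldType) (v : R * R)
  (f : R * R -> K) p :
  continuous_along v f p -> continuous_along v (fun z => `|f z|) p.
Proof. by move=> cf; apply: cvg_norm. Qed.

Section LineContinuity.
Variables (R : realType) (D : set (R * R)) (oD : open D) (v : R * R).

Local Notation CV := (fun f : R * R -> R[i] => forall p, D p ->
  @continuous_along R (R[i] : numFieldType) v f p).

Let cl : field_closed D CV := @continuous_along_closed R (R[i] : numFieldType) v D oD.

Lemma continuous_along_norm f : CV f -> CV (fun p => `|f p|).
Proof.
by move=> cf p Dp; apply: (@continuous_along_normr R (R[i] : numFieldType)); exact: cf.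
Qed.

Lemma continuous_along_norm1 m n (F : R * R -> 'M[R[i]]_(m, n)) :
  entrywise CV F -> CV (fun p => mx_norm1 (F p)).
Proof. by apply: fclosed_norm1; [exact: cl|exact: continuous_along_norm]. Qed.

Lemma continuous_along_real (f : R * R -> R) :
  continuous_on D f -> CV (fun p => (f p)%:C).
Proof.
move=> cf p Dp; apply: continuous_complex; last exact: cst_continuous.
have cp : {for (0 : R), continuous (fun t : R => p + t *: v)}.
  by apply: cvgD; [exact: cvg_cst|apply: cvgZl; exact: cvg_id].
apply: continuous_comp; first exact: cp.
by rewrite scale0r addr0; exact: cf.
Qed.

Lemma continuous_along_resolvent n (A : R * R -> 'M[R[i]]_n) (s : R[i]) :
  (forall p, D p -> pderivable v A p) ->
  (forall p, D p -> A p + s%:M \in unitmx) ->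
  entrywise CV (fun p => invmx (A p + s%:M)).
Proof.
move=> dA uA; apply: (entrywise_inv cl uA); apply: (entrywiseD cl).
  exact: pderivable_continuous_along.
exact: (entrywise_cst cl).
Qed.

End LineContinuity.

(** The adjoint of [B] stands for the resolvent of the adjoint of [A]; [adjmx_resolvent] identifies
    the two. *)
Definition complex_darboux_flow (R : realType) (n : nat) (s : R) (v : R * R)
  (alpha : R * R -> R) (J : 'M[R[i]]_2) (A S : R * R -> 'M[R[i]]_n)
  (Pi : R * R -> 'M[R[i]]_(n, 2)) (q : R * R -> 'M[R[i]]_2) (p : R * R) : Prop :=
  let a := dlog v alpha p in
  let B := invmx (A p + s%:C%:M) in
  [/\ is_pderive v A p (- a *: A p + (2 * a * s%:C) *: 1%:M - (2 * a) *: B),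
      is_pderive v Pi p (B *m Pi p *m q p) &
      is_pderive v S p (a *: (S p - 2 *: (B *m S p *m B^t*))
        - 'i *: (B *m Pi p *m q p *m J *m (Pi p)^t* *m B^t*))].

Lemma flow_A_sub (F : comNzRingType) m n (a b c : F) (A A' B B' C : 'M[F]_(m, n)) :
  - a *: A + c *: C - b *: B - (- a *: A' + c *: C - b *: B') =
  - a *: (A - A') - b *: (B - B').
Proof. by mx_linear. Qed.

Lemma flow_S_sub (F : comNzRingType) m n (a b : F) (S S' M M' X : 'M[F]_(m, n)) :
  a *: (S - b *: M) - X - (a *: (S' - b *: M') - X) =
  a *: ((S - S') - b *: (M - M')).
Proof. by mx_linear. Qed.

Section Reality.
Variables (R : realType) (n : nat) (D : set (R * R)).
Hypotheses (oD : open D) (cD : connected D) (D0 : D (0, 0)).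
Variables (alpha : R * R -> R) (J : 'M[R[i]]_2) (q Q : R * R -> 'M[R[i]]_2).
Variables (A S : R * R -> 'M[R[i]]_n) (Pi : R * R -> 'M[R[i]]_(n, 2)).
Hypothesis cdlog : forall v, v = xi_dir R \/ v = eta_dir R ->
  continuous_on D (fun p => 'D_v alpha p / alpha p).
Hypotheses (q_real : forall p, D p -> q p \is a realmx)
  (Q_real : forall p, D p -> Q p \is a realmx).
Hypotheses (dq : forall v, v = xi_dir R \/ v = eta_dir R ->
  forall p, D p -> pderivable v q p).
Hypotheses (dQ : forall v, v = xi_dir R \/ v = eta_dir R ->
  forall p, D p -> pderivable v Q p).
Hypothesis J_real : 'i *: J \is a realmx.
Hypothesis flow_xi : forall p, D p ->
  complex_darboux_flow (-1) (xi_dir R) alpha J A S Pi q p.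
Hypothesis flow_eta : forall p, D p ->
  complex_darboux_flow 1 (eta_dir R) alpha J A S Pi Q p.
Hypothesis A_sub_unit : forall p, D p -> A p + (-1)%:C%:M \in unitmx.
Hypothesis A_add_unit : forall p, D p -> A p + 1%:C%:M \in unitmx.
Hypotheses (A0 : A (0, 0) \is a realmx) (S0 : S (0, 0) \is a realmx)
  (Pi0 : Pi (0, 0) \is a realmx).

(** Lets each reality proof below treat both axes at once. *)
Let directions v : v = xi_dir R \/ v = eta_dir R ->
  exists s q', [/\ forall p, D p -> complex_darboux_flow s v alpha J A S Pi q' p,
    forall p, D p -> A p + s%:C%:M \in unitmx,
    forall p, D p -> q' p \is a realmx &
    forall p, D p -> pderivable v q' p].
Proof.
move=> v12; case: (v12) => ->.
  by exists (-1), q; split=> //; apply: dq; left.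
by exists 1, Q; split=> //; apply: dQ; right.
Qed.

Let dlog_real v p : (dlog v alpha p)^*%C = dlog v alpha p.
Proof. exact: conjc_real. Qed.

(** The equation is nonlinear, but the constant term drops out of the difference with the conjugate,
    and the difference of two resolvents is again linear in [A - conj A]. *)
Lemma flow_A_real p : D p -> A p \is a realmx.
Proof.
apply: (@pde_realmx R D _ _ A (0, 0)) => // v v12.
have [s [q' [flow uA _ _]]] := directions v12.
pose B p := invmx (A p + s%:C%:M).
have dA z : D z -> pderivable v A z by move=> /flow[[]].
have cB := continuous_along_resolvent oD dA uA.
have cl := @continuous_along_closed R (R[i] : numFieldType) v D oD.
have ca := continuous_along_real (v := v) (cdlog v12).
have cN := continuous_along_norm1 oD cB.
have c2 := fclosedM cl (fclosed_cst cl 2) ca.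
exists (fun z => `|dlog v alpha z| +
  `|2 * dlog v alpha z| * (mx_norm1 (B z) * mx_norm1 (B z))) => z Dz.
have [dAz _ _] := flow z Dz.
exists (- dlog v alpha z *: A z + (2 * dlog v alpha z * s%:C) *: 1%:M
  - (2 * dlog v alpha z) *: B z); split=> //; last first.
- have := fclosedD cl (continuous_along_norm ca)
    (fclosedM cl (continuous_along_norm c2) (fclosedM cl cN cN)).
  exact.
- rewrite !(conjmxB, conjmxD, conjmxZ) conjmx1.
  move: (dlog v alpha z) (dlog_real v z) => a ar.
  rewrite conjcN !conjcM ar conjc_nat conjc_real.
  have uAz := uA z Dz.
  have ucA : conjmx (A z) + s%:C%:M \in unitmx.
    by rewrite -[s%:C]conjc_real -map_scalar_mx -map_mxD map_unitmx.
  have cBE : conjmx (B z) = invmx (conjmx (A z) + s%:C%:M).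
    exact: conjmx_resolvent.
  (* Second resolvent identity; conjugation preserves the norm, so only the norm of [B] enters the
     coefficient. *)
  have BB : B z - conjmx (B z) = - (B z *m (A z - conjmx (A z)) *m conjmx (B z)).
    have -> : A z - conjmx (A z) = (A z + s%:C%:M) - (conjmx (A z) + s%:C%:M).
      by rewrite opprD addrACA subrr addr0.
    by rewrite mulmxBr mulmxBl mulVmx// mul1mx -mulmxA cBE mulmxV// mulmx1 opprB.
  rewrite flow_A_sub.
  apply: le_trans (mx_norm1D _ _) _; rewrite mx_norm1N !mx_norm1Z normrN [leRHS]mulrDl.
  rewrite lerD2l -mulrA ler_wpM2l// BB mx_norm1N.
  apply: le_trans (mx_norm1M _ _) _; rewrite mx_norm1_conj mulrAC.
  by rewrite ler_wpM2r ?mx_norm1_ge0// mx_norm1M.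
- by rewrite addr_ge0// mulr_ge0// mulr_ge0// mx_norm1_ge0.
Qed.

Let resolvent_real s p : D p -> conjmx (invmx (A p + s%:C%:M)) = invmx (A p + s%:C%:M).
Proof.
move=> Dp; rewrite conjmx_resolvent.
by have /realmx_conj -> := flow_A_real Dp.
Qed.

(** The resolvent is real by now and [q'] is real, so [Pi - conj Pi] satisfies the same linear
    equation as [Pi]. *)
Lemma flow_Pi_real p : D p -> Pi p \is a realmx.
Proof.
apply: (@pde_realmx R D _ _ Pi (0, 0)) => // v v12.
have [s [q' [flow uA q'real dq']]] := directions v12.
pose B p := invmx (A p + s%:C%:M).
have dA z : D z -> pderivable v A z by move=> /flow[[]].
have cl := @continuous_along_closed R (R[i] : numFieldType) v D oD.
have cN := continuous_along_norm1 oD (continuous_along_resolvent oD dA uA).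
have cq := continuous_along_norm1 oD (pderivable_continuous_along dq').
exists (fun z => mx_norm1 (B z) * mx_norm1 (q' z)) => z Dz.
have [_ dP _] := flow z Dz.
exists (B z *m Pi z *m q' z); split=> //; last exact: (fclosedM cl cN cq).
- by rewrite mulr_ge0// mx_norm1_ge0.
- have /realmx_conj qr := q'real z Dz.
  rewrite !conjmxM resolvent_real// qr -mulmxBl -mulmxBr mulrAC.
  apply: le_trans (mx_norm1M _ _) _.
  by rewrite ler_wpM2r ?mx_norm1_ge0// mx_norm1M.
Qed.

(** The source term is real, its [i] being absorbed into the real matrix [i J], and so drops out of
    [S - conj S]. *)
Lemma flow_S_real p : D p -> S p \is a realmx.
Proof.
apply: (@pde_realmx R D _ _ S (0, 0)) => // v v12.
have [s [q' [flow uA q'real dq']]] := directions v12.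
pose B p := invmx (A p + s%:C%:M).
have dA z : D z -> pderivable v A z by move=> /flow[[]].
have cl := @continuous_along_closed R (R[i] : numFieldType) v D oD.
have cB := continuous_along_resolvent oD dA uA.
have cN := continuous_along_norm1 oD cB.
have cNt := continuous_along_norm1 oD (entrywise_tr cl cB).
have ca := continuous_along_real (v := v) (cdlog v12).
exists (fun z => `|dlog v alpha z| * (1 + 2 * (mx_norm1 (B z) * mx_norm1 (B z)^T))) => z Dz.
have [_ _ dS] := flow z Dz.
eexists; split; first exact: dS.
- rewrite mulr_ge0// addr_ge0// mulr_ge0// mulr_ge0// mx_norm1_ge0//.
- have Bc : conjmx (B z) = B z by exact: resolvent_real.
  have /realmx_conj Pc := flow_Pi_real Dz.
  have Br : (B z)^t* = (B z)^T.
    by change (conjmx (B z)^T = (B z)^T); rewrite conjmx_tr Bc.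
  have Pr : (Pi z)^t* = (Pi z)^T.
    by change (conjmx (Pi z)^T = (Pi z)^T); rewrite conjmx_tr Pc.
  have /realmx_conj qr := q'real z Dz.
  have /realmx_conj Jr := J_real.
  rewrite -/(B z) Br Pr.
  have -> : 'i *: (B z *m Pi z *m q' z *m J *m (Pi z)^T *m (B z)^T) =
      B z *m Pi z *m q' z *m ('i *: J) *m (Pi z)^T *m (B z)^T.
    by rewrite !(mulmxZ, mulZmx).
  move: ('i *: J) Jr => K Kr.
  rewrite !(conjmxD, conjmxN, conjmxZ, conjmxM) !conjmx_tr Bc Pc qr Kr.
  rewrite dlog_real conjc_nat; move: (dlog v alpha z) (B z *m _ *m _ *m K *m _ *m _) => a X.
  rewrite flow_S_sub -mulmxBl -mulmxBr.
  rewrite mx_norm1Z -mulrA ler_wpM2l// [leRHS]mulrDl mul1r.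
  apply: le_trans (mx_norm1D _ _) _; rewrite lerD2l mx_norm1N mx_norm1Z normr_nat.
  rewrite -mulrA ler_wpM2l// [leRHS]mulrAC.
  apply: le_trans (mx_norm1M _ _) _.
  by rewrite ler_wpM2r ?mx_norm1_ge0// mx_norm1M.
- have := fclosedM cl (continuous_along_norm ca)
    (fclosedD cl (fclosed_cst cl 1) (fclosedM cl (fclosed_cst cl 2) (fclosedM cl cN cNt))).
  exact.
Qed.

End Reality.

(** * Sums of functions of separate variables *)

Lemma is_derive_congr_line (R : realType) (V W : normedModType R)
  (F : V -> R) (G : W -> R) (p v : V) (x w : W) (l : R) :
  (forall h : R, F (h *: v + p) = G (h *: w + x)) ->
  is_derive x w G l -> is_derive p v F l.
Proof.
move=> FG [dG <-].
have FG0 : F p = G x by have := FG 0; rewrite !scale0r !add0r.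
have E : (fun h : R => h^-1 *: (F (h *: v + p) - F p)) =
         (fun h : R => h^-1 *: (G (h *: w + x) - G x)).
  by apply/funext => h; rewrite FG FG0.
by split; [move: dG; rewrite /derivable E | rewrite /derive E].
Qed.

Section SeparatedVariables.
Variable R : realType.
Implicit Types (g : R -> R) (p : R * R).

Lemma is_derive_fst g p : derivable g p.1 1 ->
  is_derive p (xi_dir R) (g \o fst) (derive1 g p.1).
Proof.
move=> dg; rewrite derive1E.
by apply: (@is_derive_congr_line _ _ _ _ g _ _ p.1 1); last exact: derivableP.
Qed.

Lemma is_derive_snd g p : derivable g p.2 1 ->
  is_derive p (eta_dir R) (g \o snd) (derive1 g p.2).
Proof.
move=> dg; rewrite derive1E.
by apply: (@is_derive_congr_line _ _ _ _ g _ _ p.2 1); last exact: derivableP.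
Qed.

Lemma is_derive_fst_eta g p : is_derive p (eta_dir R) (g \o fst) 0.
Proof.
apply: (@is_derive_congr_line _ _ _ _ (cst (g p.1)) _ _ (0 : R) 1).
by move=> h /=; rewrite /GRing.scale/= mulr0 add0r.
Qed.

Lemma is_derive_snd_xi g p : is_derive p (xi_dir R) (g \o snd) 0.
Proof.
apply: (@is_derive_congr_line _ _ _ _ (cst (g p.2)) _ _ (0 : R) 1).
by move=> h /=; rewrite /GRing.scale/= mulr0 add0r.
Qed.

Lemma partial_C1_cst_line v (g : R * R -> R) (D : set (R * R)) :
  (forall p, is_derive p v g 0) -> continuous_on D g -> partial_C1 v D g.
Proof.
move=> dg cg p Dp; split; [exact: cg|by have [] := dg p|].
have -> : 'D_v g = cst 0 by apply/funext => z; have [_ ->] := dg z.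
exact: cst_continuous.
Qed.

(** On [D] the xi-derivative of [alpha] is [f'] composed with the first projection. It is constant
    along eta, hence differentiable there with derivative 0 although [f'] is only continuous;
    symmetrically for [h]. *)
Lemma zero_mixed_partial_C1 (D : set (R * R)) (alpha : R * R -> R) :
  open D -> zero_mixed_partial D alpha ->
  [/\ forall v, v = xi_dir R \/ v = eta_dir R -> partial_C1 v D alpha,
      partial_C1 (eta_dir R) D ('D_(xi_dir R) alpha),
      partial_C1 (xi_dir R) D ('D_(eta_dir R) alpha) &
      forall p, D p -> 'D_(eta_dir R) ('D_(xi_dir R) alpha) p = 0 /\
                       'D_(xi_dir R) ('D_(eta_dir R) alpha) p = 0].
Proof.
move=> oD [f [h H]].
have nE p : D p -> {near p, (fun z => f z.1 + h z.2) =1 alpha}.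
  move=> Dp; have := open_nbhs_nbhs (conj oD Dp).
  by apply: filterS => z Dz; have [-> _ _ _ _] := H z Dz.
have dx p : D p -> is_derive p (xi_dir R) alpha ((derive1 f \o fst) p).
  move=> Dp; have [_ df _ _ _] := H p Dp.
  apply: (near_eq_is_derive (nE p Dp)).
  apply: (is_derive_eq (is_deriveD_fun (is_derive_fst df) (is_derive_snd_xi h p))).
  by rewrite addr0.
have de p : D p -> is_derive p (eta_dir R) alpha ((derive1 h \o snd) p).
  move=> Dp; have [_ _ _ dh _] := H p Dp.
  apply: (near_eq_is_derive (nE p Dp)).
  apply: (is_derive_eq (is_deriveD_fun (is_derive_fst_eta f p) (is_derive_snd dh))).
  by rewrite add0r.
have c1 (g : R -> R) p : {for p.1, continuous g} -> {for p, continuous (g \o fst)}.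
  by move=> cg; exact: (@continuous_comp _ _ _ fst g p (@cvg_fst _ _ _ _ _) cg).
have c2 (g : R -> R) p : {for p.2, continuous g} -> {for p, continuous (g \o snd)}.
  by move=> cg; exact: (@continuous_comp _ _ _ snd g p (@cvg_snd _ _ _ _ _) cg).
have dc (g : R -> R) x : derivable g x 1 -> {for x, continuous g}.
  by move=> dg; apply: differentiable_continuous; apply/derivable1_diffP.
have cx : continuous_on D (derive1 f \o fst) by move=> p /H[_ _ cf _ _]; exact: c1.
have ce : continuous_on D (derive1 h \o snd) by move=> p /H[_ _ _ _ ch]; exact: c2.
have cl := @continuous_on_closed R (R * R)%type D oD.
have ca : continuous_on D alpha.
  apply: (fclosed_ext cl (f := fun z => (f \o fst) z + (h \o snd) z)).
    by move=> z; rewrite inE => /H[->].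
  apply: (fclosedD cl) => p /H[_ df _ dh _].
    exact/c1/dc.
  exact/c2/dc.
have Ex : {in D, (derive1 f \o fst) =1 'D_(xi_dir R) alpha}.
  by move=> z; rewrite inE => Dz; have [_ ->] := dx z Dz.
have Ee : {in D, (derive1 h \o snd) =1 'D_(eta_dir R) alpha}.
  by move=> z; rewrite inE => Dz; have [_ ->] := de z Dz.
split.
- have cdx := fclosed_ext cl Ex cx; have cde := fclosed_ext cl Ee ce.
  move=> v [->|->] p Dp; split; try exact: ca.
  + by have [] := dx p Dp.
  + exact: cdx.
  + by have [] := de p Dp.
  + exact: cde.
- apply: (fclosed_ext (partial_C1_closed _ oD) Ex).
  by apply: partial_C1_cst_line => // p; exact: is_derive_fst_eta.
- apply: (fclosed_ext (partial_C1_closed _ oD) Ee).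
  by apply: partial_C1_cst_line => // p; exact: is_derive_snd_xi.
- move=> p Dp; split.
    rewrite -(near_eq_derive _ (open_near_eq oD Ex Dp)).
    by have [] := is_derive_fst_eta (derive1 f) p.
  rewrite -(near_eq_derive _ (open_near_eq oD Ee Dp)).
  by have [] := is_derive_snd_xi (derive1 h) p.
Qed.

End SeparatedVariables.

(** * Passage between real matrices and complex matrices with real entries *)

Notation rcmx := (map_mx (real_complex _)).
Notation remx := (map_mx (@complex.Re _)).

Section RealMatrix.
Variable R : realType.
Implicit Types x y : R.

Lemma remxK m n (M : 'M[R]_(m, n)) : remx (rcmx M) = M.
Proof. by apply/matrixP => i j; rewrite !mxE. Qed.

Lemma rcmxK m n (M : 'M[R[i]]_(m, n)) : M \is a realmx -> rcmx (remx M) = M.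
Proof. by move=> /mxOverP H; apply/matrixP => i j; rewrite !mxE RRe_real. Qed.

Lemma rcmx_real m n (M : 'M[R]_(m, n)) : rcmx M \is a realmx.
Proof. by apply/mxOverP => i j; rewrite mxE; apply/complex_realP; exists (M i j). Qed.

Lemma rcmx_inj m n : injective (fun M : 'M[R]_(m, n) => rcmx M : 'M[R[i]]_(m, n)).
Proof. by move=> M N /(congr1 (fun X : 'M[R[i]]_(m, n) => remx X)); rewrite !remxK. Qed.

Lemma rcmxD m n (M N : 'M[R]_(m, n)) : rcmx (M + N) = rcmx M + rcmx N :> 'M[R[i]]_(m, n).
Proof. exact: map_mxD. Qed.

Lemma rcmxN m n (M : 'M[R]_(m, n)) : rcmx (- M) = - rcmx M :> 'M[R[i]]_(m, n).
Proof. exact: map_mxN. Qed.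

Lemma rcmxZ m n x (M : 'M[R]_(m, n)) : rcmx (x *: M) = x%:C *: rcmx M.
Proof. exact: map_mxZ. Qed.

Lemma rcmxM m n p (M : 'M[R]_(m, n)) (N : 'M[R]_(n, p)) :
  rcmx (M *m N) = rcmx M *m rcmx N :> 'M[R[i]]_(m, p).
Proof. exact: map_mxM. Qed.

Lemma rcmx1 n : rcmx (1%:M : 'M[R]_n) = 1%:M :> 'M[R[i]]_n.
Proof. exact: map_mx1. Qed.

Lemma rcmx_scalar n x : rcmx (x%:M : 'M[R]_n) = x%:C%:M :> 'M[R[i]]_n.
Proof. exact: map_scalar_mx. Qed.

Lemma rcmx_inv n (M : 'M[R]_n) : rcmx (invmx M) = invmx (rcmx M) :> 'M[R[i]]_n.
Proof. exact: map_invmx. Qed.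

Lemma rcmx_unit n (M : 'M[R]_n) : ((rcmx M : 'M[R[i]]_n) \in unitmx) = (M \in unitmx).
Proof. exact: map_unitmx. Qed.

Lemma rcmx_adj m n (M : 'M[R]_(m, n)) : (rcmx M : 'M[R[i]]_(m, n))^t* = rcmx M^T.
Proof. by apply/matrixP => i j; rewrite !mxE; exact: conjc_real. Qed.

Lemma rcmx_det n (M : 'M[R]_n) : \det (rcmx M : 'M[R[i]]_n) = (\det M)%:C.
Proof. exact: det_map_mx. Qed.

End RealMatrix.

Lemma is_pderive_re (R : realType) (v : R * R) m n
  (F : R * R -> 'M[R[i]]_(m, n)) p G :
  is_pderive v F p G -> is_mxderive v (fun z => remx (F z)) p (remx G).
Proof.
move=> [dF <-] i j; rewrite !mxE /=; have [dRe _] := dF i j.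
have -> : (fun z => remx (F z) i j) = re_entry F i j.
  by apply/funext => z; rewrite mxE.
exact: derivableP.
Qed.

Lemma is_mxderive_pderive (R : realType) (v : R * R) m n
  (F : R * R -> 'M[R[i]]_(m, n)) (Fr : R * R -> 'M[R]_(m, n)) p G :
  (\forall z \near p, F z = rcmx (Fr z)) -> is_mxderive v Fr p G ->
  is_pderive v F p (rcmx G).
Proof.
move=> FE dFr.
have dRe i j : is_derive p v (re_entry F i j) (G i j).
  apply: near_eq_is_derive (dFr i j); apply: filterS FE => z Fz.
  by rewrite /re_entry Fz mxE.
have dIm i j : is_derive p v (im_entry F i j) 0.
  apply: near_eq_is_derive (is_derive_cst 0 p v); apply: filterS FE => z Fz.
  by rewrite /im_entry Fz mxE.
split=> [i j|]; first by split; [have [] := dRe i j|have [] := dIm i j].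
apply/matrixP => i j; rewrite !mxE.
by have [_ ->] := dRe i j; have [_ ->] := dIm i j.
Qed.

Lemma det_mx22 (F : comNzRingType) (M : 'M[F]_2) :
  \det M = M 0 0 * M 1 1 - M 0 1 * M 1 0.
Proof.
rewrite (expand_det_row _ 0) !big_ord_recl big_ord0 /cofactor !det_mx11 !mxE /=.
have l0 : lift 0 0 = 1 :> 'I_2 by apply/val_inj.
have l1 : lift 1 0 = 0 :> 'I_2 by apply/val_inj.
by rewrite !l0 l1 /bump /= addn0 expr0 expr1; ring.
Qed.

(** Liouville's formula, checked on the explicit determinant of size 2. *)
Lemma is_derive_det2 (R : realType) (v p : R * R) (u : R * R -> 'M[R]_2) (q : 'M[R]_2) :
  is_mxderive v u p (q *m u p) -> is_derive p v (fun z => \det (u z)) (\tr q * \det (u p)).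
Proof.
move=> du.
have -> : (fun z => \det (u z)) = (fun z => u z 0 0 * u z 1 1 - u z 0 1 * u z 1 0).
  by apply/funext => z; exact: det_mx22.
have H := is_deriveB (is_deriveM_fun (du 0 0) (du 1 1)) (is_deriveM_fun (du 0 1) (du 1 0)).
apply: (is_derive_eq H).
rewrite det_mx22 /mxtrace !big_ord_recl !big_ord0 !mxE !big_ord_recl !big_ord0.
have -> : lift ord0 ord0 = 1 :> 'I_2 by apply/val_inj.
by ring.
Qed.

Lemma vanish_of_zero_derivatives (R : realType) (D : set (R * R)) m n
  (F : R * R -> 'M[R]_(m, n)) (p0 : R * R) :
  open D -> connected D -> D p0 -> F p0 = 0 ->
  (forall v, v = xi_dir R \/ v = eta_dir R -> forall p, D p -> is_mxderive v F p 0) ->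
  forall p, D p -> F p = 0.
Proof.
move=> oD cD Dp0 F0 dF p Dp; apply/matrixP => i j; rewrite mxE.
apply: (@vanish_connected R _ D (fun ij : 'I_m * 'I_n => fun z => F z ij.1 ij.2) p0
  oD cD Dp0 _ _ p Dp (i, j)).
  by move=> [k l] /=; rewrite F0 mxE.
move=> v v12; exists (cst 0) => z Dz; split; last exact: cst_continuous.
move=> [k l] /=; have [d ->] := dF v v12 z Dz k l; split=> //.
by rewrite mxE normr0 mul0r.
Qed.

Lemma rcM (R : realType) (x y : R) : (x * y)%:C = x%:C * y%:C.
Proof. exact: rmorphM. Qed.

Lemma rcN (R : realType) (x : R) : (- x)%:C = - x%:C.
Proof. exact: rmorphN. Qed.

Lemma rc2 (R : realType) : (2 : R)%:C = 2.
Proof. exact: (rmorph_nat (real_complex R) 2). Qed.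

Definition rcmxE := (rcmxD, rcmxN, rcmxZ, rcmxM, rcmx1, rcmx_scalar, rcmx_inv, rcM, rcN, rc2).

Lemma adjmx_resolvent (R : realType) n (M : 'M[R[i]]_n) (s : R) :
  invmx (M^t* + s%:C%:M) = (invmx (M + s%:C%:M))^t*.
Proof.
change (invmx (conjmx M^T + s%:C%:M) = conjmx (invmx (M + s%:C%:M))^T).
by rewrite !conjmx_tr conjmx_resolvent trmx_inv trmxD tr_scalar_mx.
Qed.

Lemma darboux_flow_real (R : realType) (n : nat) (s : R) (v : R * R)
  (alpha : R * R -> R) (J : 'M[R[i]]_2) (A S : R * R -> 'M[R[i]]_n)
  (Pi : R * R -> 'M[R[i]]_(n, 2)) (q : R * R -> 'M[R[i]]_2) (p : R * R) :
  complex_darboux_flow s v alpha J A S Pi q p ->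
  'i *: J \is a realmx -> A p \is a realmx -> S p \is a realmx ->
  Pi p \is a realmx -> q p \is a realmx ->
  darboux_flow s v alpha (remx ('i *: J)) (fun z => remx (A z))
    (fun z => remx (S z)) (fun z => remx (Pi z)) (fun z => remx (q z)) p.
Proof.
move=> [] + + + /rcmxK JE /rcmxK AE /rcmxK SE /rcmxK PE /rcmxK qE.
rewrite /darboux_flow /dlog; move: ('D_v alpha p / alpha p) => a dA dP dS; split.
- apply: (is_mxderive_eq (is_pderive_re dA)); rewrite -[RHS]remxK; congr (remx _).
  by rewrite !rcmxE AE.
- apply: (is_mxderive_eq (is_pderive_re dP)); rewrite -[RHS]remxK; congr (remx _).
  by rewrite !rcmxE AE PE qE.
- apply: (is_mxderive_eq (is_pderive_re dS)); rewrite -[RHS]remxK; congr (remx _).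
  rewrite !rcmxE -!rcmx_adj !rcmxE AE PE qE SE JE.
  by rewrite !(mulmxZ, mulZmx).
Qed.

(** The normalizing constant [c] cancels between the derivative and the inverse, and [alpha] cancels
    the one left in the inverse. *)
Lemma mxdlog_dressed (R : realType) (v : R * R) (alpha : R * R -> R) (c : R)
  (ut : R * R -> 'M[R[i]]_2) (V : R * R -> 'M[R]_2) (W : 'M[R]_2) (p : R * R) :
  (\forall z \near p, ut z = rcmx ((alpha z * c) *: V z)) ->
  is_mxderive v (fun z => (alpha z * c) *: V z) p (c *: (W *m V p)) ->
  alpha p != 0 -> c != 0 -> V p \in unitmx ->
  pderivable v ut p /\ (alpha p)%:C *: mxdlog v ut p = rcmx W.
Proof.
move=> utE dV a0 c0 uV; have [dut dutE] := is_mxderive_pderive utE dV.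
split=> //; rewrite /mxdlog dutE (nbhs_singleton utE) -rcmx_inv -rcmxM -rcmxZ.
congr rcmx; rewrite invmxZ; last by rewrite unitmxZ// unitfE mulf_neq0.
rewrite mulmxZ mulZmx mulmxK// !scalerA.
have -> : alpha p * ((alpha p * c)^-1 * c) = 1 by field; rewrite a0 c0.
by rewrite scale1r.
Qed.

(** [u] is real on a whole neighbourhood of [p], so its derivative is real; this is the source of
    the reality of [q] and [Q]. *)
Lemma real_mxdlog (R : realType) (D : set (R * R)) (u : R * R -> 'M[R[i]]_2) v p :
  open D -> (forall z, D z -> realGL (u z)) -> D p -> pderivable v u p ->
  mxdlog v u p \is a realmx /\
  is_mxderive v (fun z => remx (u z)) p (remx (mxdlog v u p) *m remx (u p)).
Proof.
move=> oD uGL Dp du.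
have uE : \forall z \near p, u z = rcmx (remx (u z)).
  have := open_nbhs_nbhs (conj oD Dp); apply: filterS => z /uGL[ur _].
  by rewrite rcmxK.
have dur : is_mxderive v (fun z => remx (u z)) p (remx (pderive v u p)).
  exact: is_pderive_re.
have [_ duE] := is_mxderive_pderive uE dur.
have [ur uu] := uGL p Dp.
have E : mxdlog v u p = rcmx (remx (pderive v u p) *m invmx (remx (u p))).
  by rewrite /mxdlog duE rcmxM rcmx_inv (rcmxK ur) remxK.
split; first by rewrite E rcmx_real.
rewrite E remxK mulmxKV//.
by rewrite -rcmx_unit rcmxK.
Qed.

(** * Assembly of the transformed solution *)

Unset Implicit Arguments.
Set Strict Implicit.
Set Printing Implicit Defensive.

Theorem corollary3p2 (R : realType) (n : nat)
  (D : set (R * R)) (D_open : open D) (D_conn : connected D) (D_0 : D (0, 0))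
  (alpha : R * R -> R) (u : R * R -> 'M[R[i]]_2)
  (u_eq : field_equation D alpha u)
  (alpha_mixed : zero_mixed_partial D alpha)
  (alpha_neq0 : forall p, D p -> alpha p != 0)
  (u_GL : forall p, D p -> realGL (u p))
  (q Q : R * R -> 'M[R[i]]_2)
  (q_def : forall p, D p -> q p = mxdlog (xi_dir R) u p)
  (Q_def : forall p, D p -> Q p = - mxdlog (eta_dir R) u p)
  (q_C1 : C1_on D q) (Q_C1 : C1_on D Q)
  (J : 'M[R[i]]_2)
  (J_GL : realGL ('i *: J)) (J_herm : J = J^t*) (J_inv : J^t* = invmx J)
  (q_J : forall p, D p -> q p *m J = - (J *m (q p)^t*))
  (Q_J : forall p, D p -> Q p *m J = - (J *m (Q p)^t*))
  (A0 S0 : 'M[R[i]]_n) (Pi0 : 'M[R[i]]_(n, 2))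
  (A0_GL : realGL A0) (S0_GL : realGL S0) (Pi0_real : Pi0 \is a realmx)
  (S0_herm : S0 = S0^t*)
  (triple_eq : A0 *m S0 - S0 *m A0^t* = 'i *: (Pi0 *m J *m Pi0^t*))
  (d : R[i]) (d_def : d = \det (darboux J A0 S0 Pi0 *m u (0, 0)))
  (d_gt0 : 0 < d)
  (A S : R * R -> 'M[R[i]]_n) (Pi : R * R -> 'M[R[i]]_(n, 2))
  (A_init : A (0, 0) = A0) (S_init : S (0, 0) = S0) (Pi_init : Pi (0, 0) = Pi0)
  (A_sub_unit : forall p, D p -> A p - 1%:M \in unitmx)
  (A_add_unit : forall p, D p -> A p + 1%:M \in unitmx)
  (A_xi : forall p, D p -> let a := dlog (xi_dir R) alpha p in
    is_pderive (xi_dir R) A p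
      (- a *: A p - (2 * a) *: 1%:M - (2 * a) *: invmx (A p - 1%:M)))
  (A_eta : forall p, D p -> let a := dlog (eta_dir R) alpha p in
    is_pderive (eta_dir R) A p
      (- a *: A p + (2 * a) *: 1%:M - (2 * a) *: invmx (A p + 1%:M)))
  (Pi_xi : forall p, D p ->
    is_pderive (xi_dir R) Pi p (invmx (A p - 1%:M) *m Pi p *m q p))
  (Pi_eta : forall p, D p ->
    is_pderive (eta_dir R) Pi p (invmx (A p + 1%:M) *m Pi p *m Q p))
  (S_xi : forall p, D p ->
    is_pderive (xi_dir R) S p
      (dlog (xi_dir R) alpha p *:
         (S p - 2 *: (invmx (A p - 1%:M) *m S p *m invmx ((A p)^t* - 1%:M)))
       - 'i *: (invmx (A p - 1%:M) *m Pi p *m q p *m J *m (Pi p)^t*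
                  *m invmx ((A p)^t* - 1%:M))))
  (S_eta : forall p, D p ->
    is_pderive (eta_dir R) S p
      (dlog (eta_dir R) alpha p *:
         (S p - 2 *: (invmx (A p + 1%:M) *m S p *m invmx ((A p)^t* + 1%:M)))
       - 'i *: (invmx (A p + 1%:M) *m Pi p *m Q p *m J *m (Pi p)^t*
                  *m invmx ((A p)^t* + 1%:M)))) :
  let E := [set p | [/\ D p, S p \in unitmx & A p \in unitmx]] in
  let utilde p := ((alpha p)%:C / sqrtC d) *:
                    (darboux J (A p) (S p) (Pi p) *m u p) in
  [/\ field_equation E alpha utilde,
      zero_mixed_partial D alpha,
      forall p, E p -> realGL (utilde p) &
      forall p, E p -> \det (utilde p) = (alpha p)%:C ^+ 2].
Proof.
have [alpha_C1 alpha_xi_C1 alpha_eta_C1 alpha_mixed0] :=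
  zero_mixed_partial_C1 D_open alpha_mixed.
have cdlog v (v12 : v = xi_dir R \/ v = eta_dir R) :=
  continuous_on_dlog D_open alpha_neq0 alpha_C1 v12.
have du v : v = xi_dir R \/ v = eta_dir R -> forall p, D p -> pderivable v u p.
  by move=> [->|->] p Dp; have [] := u_eq p Dp.
have vxi : xi_dir R = xi_dir R \/ xi_dir R = eta_dir R by left.
have veta : eta_dir R = xi_dir R \/ eta_dir R = eta_dir R by right.
have q_real p : D p -> q p \is a realmx.
  by move=> Dp; rewrite q_def//; have [] := real_mxdlog D_open u_GL Dp (du _ vxi p Dp).
have Q_real p : D p -> Q p \is a realmx.
  move=> Dp; rewrite Q_def// -scaleN1r; apply: mxOverZ; first by rewrite rpredN rpred1.
  by have [] := real_mxdlog D_open u_GL Dp (du _ veta p Dp).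
have dq v : v = xi_dir R \/ v = eta_dir R -> forall p, D p -> pderivable v q p.
  by move=> v12 p Dp; have [] := q_C1 p Dp v v12.
have dQ v : v = xi_dir R \/ v = eta_dir R -> forall p, D p -> pderivable v Q p.
  by move=> v12 p Dp; have [] := Q_C1 p Dp v v12.
have [J_real J_unit] := J_GL.
have m1 : (-1)%:C%:M = - 1%:M :> 'M[R[i]]_n by rewrite rcN rmorphN.
have c1 : 1%:C%:M = 1%:M :> 'M[R[i]]_n by [].
have flow_xi p : D p -> complex_darboux_flow (-1) (xi_dir R) alpha J A S Pi q p.
  move=> Dp; rewrite /complex_darboux_flow -!adjmx_resolvent m1.
  rewrite [X in X *: 1%:M]mulrC rcN mulN1r [- (2 * _) *: _]scaleNr.
  by split; [exact: A_xi|exact: Pi_xi|exact: S_xi].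
have flow_eta p : D p -> complex_darboux_flow 1 (eta_dir R) alpha J A S Pi Q p.
  move=> Dp; rewrite /complex_darboux_flow -!adjmx_resolvent c1 mulr1.
  by split; [exact: A_eta|exact: Pi_eta|exact: S_eta].
have uAm p : D p -> A p + (-1)%:C%:M \in unitmx by rewrite m1; exact: A_sub_unit.
have uAp p : D p -> A p + 1%:C%:M \in unitmx by exact: A_add_unit.
have A0r : A (0, 0) \is a realmx by rewrite A_init; case: A0_GL.
have S0r : S (0, 0) \is a realmx by rewrite S_init; case: S0_GL.
have Pi0r : Pi (0, 0) \is a realmx by rewrite Pi_init.
have A_real p : D p -> A p \is a realmx.
  exact: (flow_A_real D_open D_conn D_0 cdlog q_real Q_real dq dQ flow_xi flow_eta).
have Pi_real p : D p -> Pi p \is a realmx.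
  exact: (flow_Pi_real D_open D_conn D_0 cdlog q_real Q_real dq dQ flow_xi flow_eta).
have S_real p : D p -> S p \is a realmx.
  exact: (flow_S_real D_open D_conn D_0 cdlog q_real Q_real dq dQ J_real flow_xi flow_eta
    uAm uAp A0r S0r Pi0r).
pose K := remx ('i *: J).
have KE : rcmx K = 'i *: J by rewrite rcmxK.
pose Ar z := remx (A z); pose Sr z := remx (S z); pose Pr z := remx (Pi z).
pose qr z := remx (q z); pose Qr z := remx (Q z); pose ur z := remx (u z).
have AE p : D p -> rcmx (Ar p) = A p by move=> /A_real /rcmxK.
have SE p : D p -> rcmx (Sr p) = S p by move=> /S_real /rcmxK.
have PE p : D p -> rcmx (Pr p) = Pi p by move=> /Pi_real /rcmxK.
have qE p : D p -> rcmx (qr p) = q p by move=> /q_real /rcmxK.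
have QE p : D p -> rcmx (Qr p) = Q p by move=> /Q_real /rcmxK.
have uE p : D p -> rcmx (ur p) = u p by move=> /u_GL[/rcmxK].
have rflow_xi p : D p -> darboux_flow (-1) (xi_dir R) alpha K Ar Sr Pr qr p.
  move=> Dp; exact: (darboux_flow_real (flow_xi p Dp) J_real (A_real p Dp) (S_real p Dp)
    (Pi_real p Dp) (q_real p Dp)).
have rflow_eta p : D p -> darboux_flow 1 (eta_dir R) alpha K Ar Sr Pr Qr p.
  move=> Dp; exact: (darboux_flow_real (flow_eta p Dp) J_real (A_real p Dp) (S_real p Dp)
    (Pi_real p Dp) (Q_real p Dp)).
have ruAm p : D p -> Ar p + (-1)%:M \in unitmx.
  by move=> Dp; rewrite -rcmx_unit rcmxD rcmx_scalar AE//; exact: uAm.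
have ruAp p : D p -> Ar p + 1%:M \in unitmx.
  by move=> Dp; rewrite -rcmx_unit rcmxD rcmx_scalar AE//; exact: uAp.
have skew (q' : 'M[R[i]]_2) (qr' : 'M[R]_2) : rcmx qr' = q' ->
    q' *m J = - (J *m q'^t*) -> qr' *m K = - (K *m qr'^T).
  move=> q'E q'J; apply: rcmx_inj; rewrite /= rcmxN !rcmxM -rcmx_adj KE q'E.
  by rewrite mulmxZ mulZmx q'J scalerN.
have qK p : D p -> qr p *m K = - (K *m (qr p)^T).
  by move=> Dp; exact: (skew _ _ (qE p Dp) (q_J p Dp)).
have QK p : D p -> Qr p *m K = - (K *m (Qr p)^T).
  by move=> Dp; exact: (skew _ _ (QE p Dp) (Q_J p Dp)).
(* [J] is its own inverse, so the square of [K = iJ] is -1. *)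
have KK : K *m K = - 1%:M.
  apply: rcmx_inj; rewrite /= rcmxM rcmxN rcmx1 KE mulZmx mulmxZ scalerA.
  have -> : 'i * 'i = -1 :> R[i] by rewrite -expr2 sqr_i.
  rewrite scaleN1r {2}J_herm J_inv mulmxV//.
  by move: J_unit; rewrite unitmxZ// unitfE; apply/eqP => -[] /eqP; rewrite oner_eq0.
(* From [K^2 = -1] one gets [q' = K q'^T K], and cyclicity of the trace gives [tr q' = - tr q']. *)
have tr0 (q' : 'M[R]_2) : q' *m K = - (K *m q'^T) -> \tr q' = 0.
  move=> q'K; have q'E : q' = K *m q'^T *m K.
    by apply: oppr_inj; rewrite -mulNmx -q'K -mulmxA KK mulmxN mulmx1.
  have : \tr q' = - \tr q'.
    by rewrite {1}q'E mxtrace_mulC mulmxA KK mulNmx mul1mx raddfN /= mxtrace_tr.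
  by move/eqP; rewrite -subr_eq0 opprK -mulr2n mulrn_eq0 => /eqP.
have ASA p : D p -> Ar p *m Sr p - Sr p *m (Ar p)^T = Pr p *m K *m (Pr p)^T.
  move=> Dp; apply/eqP; rewrite -subr_eq0; apply/eqP; move: p Dp.
  apply: (@vanish_of_zero_derivatives R D _ _
    (fun p => Ar p *m Sr p - Sr p *m (Ar p)^T - Pr p *m K *m (Pr p)^T) (0, 0)) => //.
    apply: rcmx_inj; rewrite /= !(rcmxD, rcmxN, rcmxM) -!rcmx_adj AE// SE// PE// KE.
    rewrite A_init S_init Pi_init triple_eq mulmxZ mulZmx subrr.
    by apply/matrixP => i j; rewrite !mxE.
  move=> v [->|->] p Dp.
    by apply: sylvester_deriv (rflow_xi p Dp) _ _; [exact: ruAm|exact: qK].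
  by apply: sylvester_deriv (rflow_eta p Dp) _ _; [exact: ruAp|exact: QK].
have dur_xi p : D p -> is_mxderive (xi_dir R) ur p (- -1 *: (qr p *m ur p)).
  move=> Dp; have [_ H] := real_mxdlog D_open u_GL Dp (du _ vxi p Dp).
  by apply: (is_mxderive_eq H); rewrite /qr q_def// opprK scale1r.
have dur_eta p : D p -> is_mxderive (eta_dir R) ur p (- 1 *: (Qr p *m ur p)).
  move=> Dp; have [_ H] := real_mxdlog D_open u_GL Dp (du _ veta p Dp).
  apply: (is_mxderive_eq H); rewrite scaleN1r -mulNmx; congr (_ *m _).
  by apply/matrixP => i j; rewrite /Qr Q_def// !mxE raddfN /= opprK.
(* Liouville's formula with zero trace makes the determinant constant; it is wrapped as a matrix of
   size 1 to reuse the propagation lemma. *)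
have det_u p : D p -> \det (ur p) = \det (ur (0, 0)).
  move=> Dp; apply/eqP; rewrite -subr_eq0.
  have H : forall p, D p -> const_mx (\det (ur p) - \det (ur (0, 0))) = 0 :> 'M[R]_1.
    apply: (@vanish_of_zero_derivatives R D _ _
      (fun p => const_mx (\det (ur p) - \det (ur (0, 0))) : 'M[R]_1) (0, 0)) => //.
      by apply/matrixP => i j; rewrite !mxE subrr.
    move=> v v12 z Dz i j; rewrite mxE.
    have -> : (fun z0 => (const_mx (\det (ur z0) - \det (ur (0, 0))) : 'M[R]_1) i j) =
        (fun z0 => \det (ur z0) - \det (ur (0, 0))).
      by apply/funext => z0; rewrite mxE.
    have dz : is_derive z v (fun z => \det (ur z)) 0.
      case: v12 => ->.
        have H : is_mxderive (xi_dir R) ur z (qr z *m ur z).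
          by apply: (is_mxderive_eq (dur_xi z Dz)); rewrite opprK scale1r.
        by apply: (is_derive_eq (is_derive_det2 H)); rewrite tr0 ?mul0r// qK.
      have H : is_mxderive (eta_dir R) ur z (- Qr z *m ur z).
        by apply: (is_mxderive_eq (dur_eta z Dz)); rewrite scaleN1r mulNmx.
      apply: (is_derive_eq (is_derive_det2 H)).
      by rewrite raddfN /= tr0 ?oppr0 ?mul0r// QK.
    by apply: (is_derive_eq (is_deriveB dz (is_derive_cst _ z v))); rewrite subr0.
  by have := congr1 (fun M : 'M[R]_1 => M 0 0) (H p Dp); rewrite !mxE => ->.
have real_C1 (q' : R * R -> 'M[R[i]]_2) : C1_on D q' ->
    forall v, v = xi_dir R \/ v = eta_dir R ->
    entrywise (partial_C1 v D) (fun z => remx (q' z)).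
  move=> q'C1; apply: C1_partial => // v p v12 Dp i j.
  have [dq' cq'] := q'C1 p Dp v v12; have [cRe _] := cq' i j.
  have -> : (fun z => remx (q' z) i j) = re_entry q' i j.
    by apply/funext => z; rewrite mxE.
  split; first by have [] := dq' i j.
  have <- : re_entry (pderive v q') i j = 'D_v (re_entry q' i j).
    by apply/funext => z; rewrite /re_entry mxE.
  exact: cRe.
have rq_C1 := real_C1 q q_C1; have rQ_C1 := real_C1 Q Q_C1.
pose Er := [set p | [/\ D p, Sr p \in unitmx & Ar p \in unitmx]].
have oE : open Er.
  exact: (open_darboux_domain D_open alpha_neq0 alpha_C1 rq_C1 rQ_C1 rflow_xi rflow_eta
    ruAm ruAp).
move=> E utilde.
have EEr p : E p -> Er p.
  by move=> [Dp uS uA]; split=> //; rewrite -rcmx_unit ?SE ?AE.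
(* Positivity in the order of [R[i]] includes a zero imaginary part, so the square root of [d] is a
   positive real. *)
have [r r0 rE] : exists2 r : R, 0 < r & sqrtC d = r%:C.
  have : 0 < sqrtC d by rewrite sqrtC_gt0.
  rewrite ltcE => /andP[/eqP Im0 Re0]; exists (complex.Re (sqrtC d)) => //.
  by case: (sqrtC d) Im0 Re0 => a b /= ->.
pose U z := 1%:M - K *m (Pr z)^T *m invmx (Sr z) *m invmx (Ar z) *m Pr z.
pose V z := U z *m ur z.
have darbouxE p : D p -> darboux J (A p) (S p) (Pi p) = rcmx (U p).
  move=> Dp; rewrite /U rcmxD rcmxN rcmx1 !rcmxM !rcmx_inv KE -rcmx_adj.
  by rewrite AE// SE// PE// /darboux !mulZmx.
have utE p : D p -> utilde p = rcmx ((alpha p * r^-1) *: V p).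
  move=> Dp; rewrite /utilde darbouxE// -uE// rE -rcmxM rcmxZ; congr (_ *: _).
  by rewrite rcM; congr (_ * _); rewrite fmorphV.
have det_U p : Er p -> \det (U p) = 1.
  by move=> [Dp uS uA]; apply: det_darboux => //; exact: ASA.
have Er0 : Er (0, 0).
  split=> //; rewrite -rcmx_unit ?SE ?AE// ?S_init ?A_init; [by case: S0_GL|by case: A0_GL].
(* Since the Darboux matrix at the origin has determinant 1, [d] is just the determinant of [u]
   there. *)
have r2 : \det (ur (0, 0)) = r ^+ 2.
  apply: (@complexI R); rewrite rmorphXn /= -rE sqrtCK d_def -A_init -S_init -Pi_init.
  by rewrite darbouxE// -uE// -rcmxM rcmx_det det_mulmx det_U// mul1r.
have uV p : Er p -> V p \in unitmx.
  move=> Ep; have [Dp _ _] := Ep.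
  by rewrite unitmxE det_mulmx det_U// mul1r det_u// r2 unitfE expf_neq0// gt_eqF.
have ri0 : r^-1 != 0 by rewrite invr_eq0 gt_eqF.
have nEr p : Er p -> \forall z \near p, Er z.
  by move=> Ep; exact: open_nbhs_nbhs.
have currents p : Er p ->
    [/\ pderivable (xi_dir R) utilde p, pderivable (eta_dir R) utilde p,
        (alpha p)%:C *: mxdlog (xi_dir R) utilde p =
          rcmx (dressed_current (-1) (xi_dir R) alpha K Ar Sr Pr qr p) &
        (alpha p)%:C *: mxdlog (eta_dir R) utilde p =
          rcmx (dressed_current 1 (eta_dir R) alpha K Ar Sr Pr Qr p)].
  move=> Ep; have [Dp uS uA] := Ep.
  have nE : \forall z \near p, utilde z = rcmx ((alpha z * r^-1) *: V z).
    by apply: filterS (nEr p Ep) => z [Dz _ _]; exact: utE.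
  have dx : is_mxderive (xi_dir R) (fun z => (alpha z * r^-1) *: V z) p
      (r^-1 *: (dressed_current (-1) (xi_dir R) alpha K Ar Sr Pr qr p *m V p)).
    apply: (darboux_solution_deriv D_open alpha_neq0 alpha_C1 rq_C1 rQ_C1 rflow_xi
      rflow_eta ruAm ruAp ASA vxi _ qK rflow_xi ruAm) => //.
      by rewrite mulrNN mulr1.
    exact: dur_xi.
  have de : is_mxderive (eta_dir R) (fun z => (alpha z * r^-1) *: V z) p
      (r^-1 *: (dressed_current 1 (eta_dir R) alpha K Ar Sr Pr Qr p *m V p)).
    apply: (darboux_solution_deriv D_open alpha_neq0 alpha_C1 rq_C1 rQ_C1 rflow_xi
      rflow_eta ruAm ruAp ASA veta _ QK rflow_eta ruAp) => //.
      by rewrite mulr1.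
    exact: dur_eta.
  have [h1 h2] := mxdlog_dressed nE dx (alpha_neq0 p Dp) ri0 (uV p Ep).
  have [h3 h4] := mxdlog_dressed nE de (alpha_neq0 p Dp) ri0 (uV p Ep).
  by split.
split; [|exact: alpha_mixed| |].
- pose Fxi z := (alpha z)%:C *: mxdlog (xi_dir R) utilde z.
  pose Feta z := (alpha z)%:C *: mxdlog (eta_dir R) utilde z.
  change (forall p, E p -> [/\ pderivable (xi_dir R) utilde p,
    pderivable (eta_dir R) utilde p, pderivable (eta_dir R) Fxi p,
    pderivable (xi_dir R) Feta p &
    pderive (eta_dir R) Fxi p + pderive (xi_dir R) Feta p = 0]).
  move=> p /EEr Ep; have [Dp _ _] := Ep.
  have [h1 h2 _ _] := currents p Ep.
  have [_ _ dF dG FG] := u_eq p Dp.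
  set X := pderive (eta_dir R) _ p in FG.
  have nD : \forall z \near p, D z by exact: open_nbhs_nbhs.
  have dqX : is_mxderive (eta_dir R) (fun z => alpha z *: qr z) p (remx X).
    apply: is_mxderive_near (is_pderive_re (conj dF erefl)).
    by apply: filterS nD => z Dz; rewrite -q_def// -qE// -rcmxZ remxK.
  (* The sign in the definition of [Q] turns the field equation of [u] into equality of the
     derivatives of [alpha q] and [alpha Q], whence the same [X]. *)
  have dQX : is_mxderive (xi_dir R) (fun z => alpha z *: Qr z) p (remx X).
    have FG' : remx X = - remx (pderive (xi_dir R)
        (fun z => (alpha z)%:C *: mxdlog (eta_dir R) u z) p).
      move/eqP: FG; rewrite addr_eq0 => /eqP ->.
      by apply/matrixP => i j; rewrite !mxE raddfN.
    rewrite FG'.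
    apply: is_mxderive_near (is_mxderiveN (is_pderive_re (conj dG erefl))).
    apply: filterS nD => z Dz.
    have -> : mxdlog (eta_dir R) u z = - Q z by rewrite Q_def// opprK.
    by rewrite -QE// -rcmxN -rcmxZ remxK scalerN opprK.
  have [Y YF YG] := darboux_field_equation D_open alpha_neq0 alpha_C1 alpha_xi_C1
    alpha_eta_C1 alpha_mixed0 rq_C1 rQ_C1 qK QK rflow_xi rflow_eta ruAm ruAp ASA Ep
    dqX dQX.
  have nF : \forall z \near p, Fxi z =
      rcmx (dressed_current (-1) (xi_dir R) alpha K Ar Sr Pr qr z).
    by apply: filterS (nEr p Ep) => z Ez; have [_ _ h _] := currents z Ez; rewrite -h.
  have nG : \forall z \near p, Feta z =
      rcmx (dressed_current 1 (eta_dir R) alpha K Ar Sr Pr Qr z).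
    by apply: filterS (nEr p Ep) => z Ez; have [_ _ _ h] := currents z Ez; rewrite -h.
  have [dF' FE] := is_mxderive_pderive nF YF.
  have [dG' GE] := is_mxderive_pderive nG YG.
  split; [exact: h1|exact: h2|exact: dF'|exact: dG'|].
  by rewrite FE GE rcmxN subrr.
- move=> p Ep; have Erp := EEr p Ep; have [Dp _ _] := Ep.
  rewrite utE//; split; first exact: rcmx_real.
  by rewrite rcmx_unit unitmxZ ?uV// unitfE mulf_neq0// alpha_neq0.
- move=> p Ep; have Erp := EEr p Ep; have [Dp _ _] := Ep.
  (* The scalar factor is squared, and [r^(-2)] cancels the constant determinant [r^2] of [u]. *)
  rewrite utE// rcmx_det detZ det_mulmx det_U// mul1r det_u// r2 -rmorphXn /=.
  congr (_%:C); rewrite exprMn -mulrA -exprMn mulVf ?gt_eqF//.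
  by rewrite expr1n mulr1.
Qed.
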